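(* Let $\kappa=\kappa(z)$ be a continuous function. Then the problem of determining locally a spherical curve whose curvature is $\kappa(z)$, where $z$ represents the (non-constant) signed distance to the great circle $z=0$, with spherical angular momentum $\mathcal K(z)$ satisfying $d\mathcal K=\kappa(z)\,dz$, is solvable by quadratures, considering the unit-speed curve $\xi(s)=(x(s),y(s),z(s))$ with $$x(s)=\cos\varphi(s)\cos\lambda(s),\qquad y(s)=\cos\varphi(s)\sin\lambda(s),\qquad z(s)=\sin\varphi(s),$$ where $\varphi(s)$ and $\lambda(s)$ are obtained through $$ds=\frac{\cos\varphi\,d\varphi}{\sqrt{\cos^2\varphi-\mathcal K^2}}=\frac{dz}{\sqrt{1-z^2-\mathcal K(z)^2}}\qquad\text{and}\qquad d\lambda=-\frac{\mathcal K\,ds}{\cos^2\varphi}=\frac{\mathcal K\,ds}{z^2-1}$$ after inverting $s=s(z)$ (where $\mathcal K(z)^2+z^2<1$). Such a curve is uniquely determined by $\mathcal K(z)$ up to a rotation around the $z$-axis (and a translation of the arc parameter $s$).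
   Context: $\mathbb{S}^2\subset\mathbb{R}^3$ is the unit sphere centred at the origin; a spherical curve is an immersed curve $\xi=(x,y,z)$ in $\mathbb{S}^2$ parametrized by arc length $s$, and a dot denotes the derivative with respect to $s$. Put $N=\xi\times\dot\xi$. The oriented geodesic curvature $\kappa$ is defined by $\ddot\xi=-\xi+\kappa N$, i.e. $\kappa=\det(\xi,\dot\xi,\ddot\xi)$. Geographical coordinates are $\xi=(\cos\varphi\cos\lambda,\cos\varphi\sin\lambda,\sin\varphi)$ (latitude $\varphi$, longitude $\lambda$), so $z=\sin\varphi$; $z=\langle\xi,\mathbf e\rangle$ with $\mathbf e=(0,0,1)$ is called the signed distance to the great circle $\mathbb{S}^2\cap\{z=0\}$. The spherical angular momentum of $\xi$ (with respect to the $z$-axis) is $$\mathcal K=-\det(\xi,\dot\xi,\mathbf e)=-\langle N,\mathbf e\rangle=\dot x\,y-x\,\dot y=-\dot\lambda\cos^2\varphi .$$ When the curvature is a function $\kappa(z)$ of $z$ and $z$ is non-constant, $\mathcal K$ is regarded as a function $\mathcal K(z)$, an anti-derivative of $\kappa(z)$. *)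

(* Defs.v *)
From Stdlib Require Import Reals.
From Coquelicot Require Import Coquelicot.

Open Scope R_scope.

Definition vec3 : Type := (R * R * R)%type.

Definition xc (v : vec3) : R := fst (fst v).
Definition yc (v : vec3) : R := snd (fst v).
Definition zc (v : vec3) : R := snd v.

Definition dot (u v : vec3) : R := xc u * xc v + yc u * yc v + zc u * zc v.

Definition cross (u v : vec3) : vec3 :=
  (yc u * zc v - zc u * yc v,
   zc u * xc v - xc u * zc v,
   xc u * yc v - yc u * xc v).

(* Determinant of the matrix with columns u, v, w, as a triple product. *)
Definition det3 (u v w : vec3) : R := dot (cross u v) w.

Definition e_z : vec3 := (0, 0, 1).

Definition is_open_interval (I : R -> Prop) : Prop :=
  open I /\ (exists t, I t) /\
  (forall a b t, I a -> I b -> a <= t <= b -> I t).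

Definition velocity (xi : R -> vec3) (s : R) : vec3 :=
  (Derive (fun t => xc (xi t)) s,
   Derive (fun t => yc (xi t)) s,
   Derive (fun t => zc (xi t)) s).

Definition acceleration (xi : R -> vec3) : R -> vec3 := velocity (velocity xi).

Definition C2_at (f : R -> R) (s : R) : Prop :=
  ex_derive f s /\ ex_derive (Derive f) s /\ continuous (Derive (Derive f)) s.

(* Arc-length parametrized curve of class C^2 in the unit sphere: C^2 is the
   regularity matching a continuous geodesic curvature. *)
Definition spherical_curve (I : R -> Prop) (xi : R -> vec3) : Prop :=
  is_open_interval I /\
  forall s, I s ->
    C2_at (fun t => xc (xi t)) s /\
    C2_at (fun t => yc (xi t)) s /\
    C2_at (fun t => zc (xi t)) s /\
    dot (xi s) (xi s) = 1 /\
    dot (velocity xi s) (velocity xi s) = 1.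

Definition geodesic_curvature (xi : R -> vec3) (s : R) : R :=
  det3 (xi s) (velocity xi s) (acceleration xi s).

Definition angular_momentum (xi : R -> vec3) (s : R) : R :=
  - det3 (xi s) (velocity xi s) e_z.

(* Signed distance, in the sense <xi, e_z>, to the great circle z = 0. *)
Definition height (xi : R -> vec3) (s : R) : R := dot (xi s) e_z.

(* The function kappa (resp. K) lives on the interval J of values of z. *)
Definition has_curvature (kappa : R -> R) (J I : R -> Prop) (xi : R -> vec3)
  : Prop :=
  forall s, I s ->
    J (height xi s) /\ geodesic_curvature xi s = kappa (height xi s).

Definition has_momentum (K : R -> R) (J I : R -> Prop) (xi : R -> vec3)
  : Prop :=
  forall s, I s ->
    J (height xi s) /\ angular_momentum xi s = K (height xi s).

Definition antiderivative_on (J : R -> Prop) (kappa K : R -> R) : Prop :=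
  forall z, J z -> is_derive K z (kappa z).

Definition admissible (K : R -> R) (J J' : R -> Prop) : Prop :=
  is_open_interval J' /\
  forall z, J' z -> J z /\ K z ^ 2 + z ^ 2 < 1.

Definition geographic (phi lambda : R) : vec3 :=
  (cos phi * cos lambda, cos phi * sin lambda, sin phi).

(* ds = dz / sqrt (1 - z^2 - K(z)^2), integrated from (z0, s0). *)
Definition arc_length_z (K : R -> R) (z0 s0 z : R) : R :=
  s0 + RInt (fun t => 1 / sqrt (1 - t ^ 2 - K t ^ 2)) z0 z.

(* ds = cos phi dphi / sqrt (cos^2 phi - K^2), integrated from (phi0, s0). *)
Definition arc_length_phi (K : R -> R) (phi0 s0 phi : R) : R :=
  s0 + RInt (fun u => cos u / sqrt (cos u ^ 2 - K (sin u) ^ 2)) phi0 phi.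

(* xi is produced on I by the quadratures: z : I -> J is the inverse of
   s = s(z) on J, phi is the latitude with sin phi = z, and lambda is the
   integral of either form of dlambda.  The constants of integration are
   s = s0 and lambda = lambda0 at z = z0. *)
Definition by_quadratures (K : R -> R) (J I : R -> Prop) (z0 s0 lambda0 : R)
    (xi : R -> vec3) : Prop :=
  exists z phi lambda : R -> R,
    (forall zeta, J zeta ->
       I (arc_length_z K z0 s0 zeta) /\ z (arc_length_z K z0 s0 zeta) = zeta) /\
    (forall s, I s ->
       J (z s) /\ arc_length_z K z0 s0 (z s) = s) /\
    (forall s, I s ->
       - (PI / 2) < phi s < PI / 2 /\
       z s = sin (phi s) /\
       s = arc_length_phi K (phi s0) s0 (phi s) /\
       lambda s = lambda0 + RInt (fun t => - (K (z t) / cos (phi t) ^ 2)) s0 s /\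
       lambda s = lambda0 + RInt (fun t => K (z t) / (z t ^ 2 - 1)) s0 s /\
       xi s = geographic (phi s) (lambda s)).

Definition rot_z (theta : R) (v : vec3) : vec3 :=
  (cos theta * xc v - sin theta * yc v,
   sin theta * xc v + cos theta * yc v,
   zc v).

(* Reversing the arc parameter together with the reflection y -> - y preserves
   both the geodesic curvature and the angular momentum as functions of z, and
   exchanges the curves with dz/ds > 0 and those with dz/ds < 0. *)
Definition reversed (I : R -> Prop) : R -> Prop := fun s => I (- s).

Definition mirror_reversed (xi : R -> vec3) : R -> vec3 :=
  fun s => (xc (xi (- s)), - yc (xi (- s)), zc (xi (- s))).

Definition height_range (I : R -> Prop) (xi : R -> vec3) : R -> Prop :=
  fun zeta => exists s, I s /\ height xi s = zeta.

(* K is the angular momentum of xi as a function of z, and K(z)^2 + z^2 < 1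
   along xi. *)
Definition momentum_solution (K : R -> R) (J I : R -> Prop) (xi : R -> vec3)
  : Prop :=
  spherical_curve I xi /\ has_momentum K J I xi /\
  forall s, I s -> K (height xi s) ^ 2 + height xi s ^ 2 < 1.

(* Main.v *)
(** Differentiating K = x'y - xy' along a curve gives K' = kappa z', because
    xi'' = - xi + kappa N; so K is an antiderivative of kappa as a function of z,
    and the orthonormal frame (xi, xi', N) gives z'^2 + z^2 + K^2 = 1.  Hence
    z' = +- sqrt (1 - z^2 - K(z)^2) and s(z) is inverted by the inverse function
    theorem in one variable.  Two curves with the same heights and the same K
    have planar projections whose scalar and cross products are constant
    multiples of 1 - z^2, so they differ by a rotation around the z-axis; the
    formula for the longitude follows by comparing a given curve with the one
    constructed by the quadratures. *)

Require Import Defs.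
From Stdlib Require Import Reals Lra Ranalysis5 ClassicalEpsilon.
From Coquelicot Require Import Coquelicot.

Open Scope R_scope.

(** The positive square root in the quadratures only yields curves along which z increases. A
    solution with K(z)^2 + z^2 < 1 has z' nowhere zero, hence of one sign by the intermediate value
    theorem, and a decreasing one is made increasing by the mirror reversal. Regularity is tight:
    kappa is merely continuous, so K and sqrt (1 - z^2 - K^2) are only C^1 in z, and a curve of
    class C^2 leaves no derivative to spare. Therefore x' and y' of the constructed curve are
    re-expressed through x, y, z, z' and K, all of class C^1, and its curvature is read off from K'
    = kappa z' by cancelling z' > 0 instead of computing xi''. Likewise no continuous longitude is
    ever extracted from a given curve: the rotation angle between it and a constructed curve with
    lambda0 = 0 is the missing constant lambda0. *)

Lemma ball_Rabs (x e y : R) : ball x e y <-> Rabs (y - x) < e.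
Proof. split; intro H; exact H. Qed.

(** * Rules of differentiation for real functions *)

Lemma is_derive_continuous (f : R -> R) (x l : R) :
  is_derive f x l -> continuous f x.
Proof. intros H; apply (@ex_derive_continuous R_AbsRing R_NormedModule); now exists l. Qed.

Lemma is_derive_continuity_pt (f : R -> R) (x l : R) :
  is_derive f x l -> continuity_pt f x.
Proof. intros H; apply continuity_pt_filterlim; exact (is_derive_continuous f x l H). Qed.

Lemma is_derive_eq (f : R -> R) (x l l' : R) :
  is_derive f x l -> l = l' -> is_derive f x l'.
Proof. now intros H <-. Qed.

Lemma is_derive_Rmult (f g : R -> R) (x df dg : R) :
  is_derive f x df -> is_derive g x dg ->
  is_derive (fun t => f t * g t) x (df * g x + f x * dg).
Proof.
intros Hf Hg.
exact (is_derive_mult f g x df dg Hf Hg Rmult_comm).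
Qed.

Lemma is_derive_Rplus (f g : R -> R) (x df dg : R) :
  is_derive f x df -> is_derive g x dg ->
  is_derive (fun t => f t + g t) x (df + dg).
Proof. intros Hf Hg; exact (is_derive_plus f g x df dg Hf Hg). Qed.

Lemma is_derive_Rminus (f g : R -> R) (x df dg : R) :
  is_derive f x df -> is_derive g x dg ->
  is_derive (fun t => f t - g t) x (df - dg).
Proof. intros Hf Hg; exact (is_derive_minus f g x df dg Hf Hg). Qed.

Lemma is_derive_Ropp (f : R -> R) (x df : R) :
  is_derive f x df -> is_derive (fun t => - f t) x (- df).
Proof. intros Hf; exact (is_derive_opp f x df Hf). Qed.

Lemma is_derive_Rcomp (f g : R -> R) (x df dg : R) :
  is_derive f (g x) df -> is_derive g x dg ->
  is_derive (fun t => f (g t)) x (df * dg).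
Proof.
intros Hf Hg; apply is_derive_eq with (1 := is_derive_comp f g x df dg Hf Hg).
apply Rmult_comm.
Qed.

Lemma is_derive_Rconst (a x : R) : is_derive (fun _ => a) x 0.
Proof. exact (is_derive_const a x). Qed.

(** * Calculus on open intervals *)

Lemma open_interval_between (I : R -> Prop) (a b t : R) :
  is_open_interval I -> I a -> I b -> Rmin a b <= t <= Rmax a b -> I t.
Proof.
intros (_ & _ & H) Ha Hb Ht.
destruct (Rle_dec a b) as [Hab | Hab].
- rewrite Rmin_left, Rmax_right in Ht by lra. now apply (H a b).
- rewrite Rmin_right, Rmax_left in Ht by lra. now apply (H b a).
Qed.

Lemma open_interval_locally (I : R -> Prop) (t : R) :
  is_open_interval I -> I t -> locally t I.
Proof. intros [H _]; exact (H t). Qed.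

Lemma open_interval_ext (I I' : R -> Prop) :
  (forall t, I t <-> I' t) -> is_open_interval I -> is_open_interval I'.
Proof.
intros E (Ho & [t0 Ht0] & Hc); split; [ | split].
- intros t Ht; apply E in Ht.
  apply filter_imp with (2 := Ho t Ht); intros u; apply E.
- exists t0; now apply E.
- intros a b t Ha Hb Ht; apply E; apply (Hc a b t); now try apply E.
Qed.

Lemma open_interval_reversed (I : R -> Prop) :
  is_open_interval I -> is_open_interval (reversed I).
Proof.
unfold reversed; intros (Ho & [t0 Ht0] & Hc); split; [ | split].
- intros t Ht; destruct (Ho _ Ht) as [d Hd]; exists d; intros u Hu.
  apply Hd; apply ball_Rabs; apply ball_Rabs in Hu.
  now replace (- u - - t) with (- (u - t)) by ring; rewrite Rabs_Ropp.
- exists (- t0); now rewrite Ropp_involutive.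
- intros a b t Ha Hb Ht; apply (Hc (- b) (- a)); try easy; lra.
Qed.

Lemma MVT_open_interval (I : R -> Prop) (f df : R -> R) (a b : R) :
  is_open_interval I -> (forall t, I t -> is_derive f t (df t)) ->
  I a -> I b ->
  exists c, I c /\ Rmin a b <= c <= Rmax a b /\ f b - f a = df c * (b - a).
Proof.
intros HI Hf Ha Hb.
destruct (MVT_gen f a b df) as (c & Hc & E).
- intros x Hx; apply Hf, (open_interval_between I a b); try easy; lra.
- intros x Hx; apply is_derive_continuity_pt with (df x).
  now apply Hf, (open_interval_between I a b).
- exists c; split; [ | now split].
  now apply (open_interval_between I a b).
Qed.

Lemma zero_derivative_open_interval (I : R -> Prop) (f : R -> R) (a b : R) :
  is_open_interval I -> (forall t, I t -> is_derive f t 0) ->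
  I a -> I b -> f a = f b.
Proof.
intros HI Hf Ha Hb.
destruct (MVT_open_interval I f (fun _ => 0) a b) as (c & _ & _ & E); try easy.
lra.
Qed.

Lemma pos_derivative_increasing (I : R -> Prop) (f df : R -> R) (a b : R) :
  is_open_interval I -> (forall t, I t -> is_derive f t (df t)) ->
  (forall t, I t -> 0 < df t) -> I a -> I b -> a < b -> f a < f b.
Proof.
intros HI Hf Hp Ha Hb Hab.
destruct (MVT_open_interval I f df a b) as (c & Hc & _ & E); try easy.
specialize (Hp c Hc); nra.
Qed.

Lemma IVT_open_interval (I : R -> Prop) (f : R -> R) (a b y : R) :
  is_open_interval I -> (forall t, I t -> continuous f t) ->
  I a -> I b -> a < b -> f a < y < f b ->
  exists t, I t /\ a <= t <= b /\ f t = y.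
Proof.
intros HI Hf Ha Hb Hab Hy.
assert (HI' : forall t, a <= t <= b -> I t)
  by (intros t Ht; now apply (proj2 (proj2 HI) a b)).
destruct (IVT_interv (fun t => f t - y) a b) as (t & Ht & E); try lra.
- intros t Ht; apply continuity_pt_minus.
  + apply continuity_pt_filterlim, Hf; now apply HI'.
  + apply continuity_pt_const; now intros ? ?.
- exists t; split; [now apply HI' | split; [easy | lra]].
Qed.

(** Openness of an increasing map, with control of the preimages: the intermediate value theorem on
    [t0 - e, t0 + e] reaches every y near [f t0] from within [eps] of [t0]. The bound on [t] stands
    in for continuity of the inverse in [is_derive_inverse]. *)
Lemma image_locally (I : R -> Prop) (f df : R -> R) (t0 : R) (eps : posreal) :
  is_open_interval I -> (forall t, I t -> is_derive f t (df t)) ->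
  (forall t, I t -> 0 < df t) -> I t0 ->
  locally (f t0) (fun y => exists t, I t /\ Rabs (t - t0) < eps /\ f t = y).
Proof.
intros HI Hf Hp Ht0.
destruct (open_interval_locally I t0 HI Ht0) as [d Hd].
set (e := Rmin d eps / 2).
assert (He : 0 < e /\ e < d /\ e < eps).
{ unfold e, Rmin; generalize (cond_pos d) (cond_pos eps).
  destruct (Rle_dec d eps); lra. }
assert (Hm : I (t0 - e) /\ I (t0 + e)).
{ split; apply Hd, ball_Rabs.
  - replace (t0 - e - t0) with (- e) by ring; rewrite Rabs_Ropp, Rabs_pos_eq; lra.
  - replace (t0 + e - t0) with e by ring; rewrite Rabs_pos_eq; lra. }
assert (H1 : f (t0 - e) < f t0)
  by (apply (pos_derivative_increasing I f df); try easy; lra).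
assert (H2 : f t0 < f (t0 + e))
  by (apply (pos_derivative_increasing I f df); try easy; lra).
apply (locally_interval _ _ (f (t0 - e)) (f (t0 + e))); try easy.
intros y Hy1 Hy2; simpl in Hy1, Hy2.
destruct (IVT_open_interval I f (t0 - e) (t0 + e) y) as (t & Ht & Hte & E);
  try easy; try lra.
- intros t Ht; now apply is_derive_continuous with (df t), Hf.
- exists t; split; [easy | split; [ | easy]].
  apply Rabs_def1; lra.
Qed.

Lemma image_open_interval (I : R -> Prop) (f df : R -> R) :
  is_open_interval I -> (forall t, I t -> is_derive f t (df t)) ->
  (forall t, I t -> 0 < df t) ->
  is_open_interval (fun y => exists t, I t /\ f t = y).
Proof.
intros HI Hf Hp; split; [ | split].
- intros y (t & Ht & <-).
  apply filter_imp with (2 := image_locally I f df t (mkposreal 1 Rlt_0_1) HI Hf Hp Ht).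
  intros y (u & Hu & _ & E); now exists u.
- destruct HI as (_ & [t Ht] & _); now exists (f t), t.
- intros y1 y2 y (a & Ha & <-) (b & Hb & <-) Hy.
  destruct (Req_dec y (f a)) as [-> | Na]; [now exists a | ].
  destruct (Req_dec y (f b)) as [-> | Nb]; [now exists b | ].
  assert (Hab : a < b).
  { destruct (Rtotal_order a b) as [H | [H | H]]; [easy | subst; lra | ].
    assert (f b < f a) by (now apply (pos_derivative_increasing I f df)).
    lra. }
  destruct (IVT_open_interval I f a b y) as (t & Ht & _ & E); try easy; try lra.
  + intros t Ht; now apply is_derive_continuous with (df t), Hf.
  + now exists t.
Qed.

(** The difference quotient of [g] at [f t0] is the reciprocal of one of [f], which the mean value
    theorem makes equal to [/ df c] for some [c] between [t0] and the preimage [t] of [f t0 + h]. As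
    [t] is within [d] of [t0], so is [c], and continuity of [/ df] concludes. *)
Lemma is_derive_inverse (I : R -> Prop) (f df g : R -> R) (t0 : R) :
  is_open_interval I -> (forall t, I t -> is_derive f t (df t)) ->
  (forall t, I t -> 0 < df t) -> (forall t, I t -> continuous df t) ->
  (forall t, I t -> g (f t) = t) -> I t0 ->
  is_derive g (f t0) (/ df t0).
Proof.
intros HI Hf Hp Hc Hg Ht0.
apply is_derive_Reals; intros eps Heps.
assert (Hinv : continuous (fun t => / df t) t0).
{ apply continuous_Rinv_comp; [now apply Hc | specialize (Hp t0 Ht0); lra]. }
destruct (proj1 (filterlim_locally _ _) Hinv (mkposreal eps Heps)) as [d Hd].
destruct (image_locally I f df t0 d HI Hf Hp Ht0) as [e He].
exists e; intros h Hh0 Hh.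
destruct (He (f t0 + h)) as (t & Ht & Htd & E).
{ apply ball_Rabs; now replace (f t0 + h - f t0) with h by ring. }
rewrite <- E, !Hg by easy.
destruct (MVT_open_interval I f df t0 t) as (c & Hci & Hct & Ec); try easy.
assert (Hcd : Rabs (c - t0) < d).
{ apply Rle_lt_trans with (2 := Htd).
  unfold Rmin, Rmax in Hct; destruct (Rle_dec t0 t).
  - rewrite !Rabs_pos_eq; lra.
  - rewrite !Rabs_left1; lra. }
assert (Hpc := Hp c Hci).
replace ((t - t0) / h) with (/ df c).
- exact (Hd c Hcd).
- replace h with (df c * (t - t0)) by lra.
  field; split; [ | lra].
  intros Z; apply Hh0; replace h with (df c * (t - t0)) by lra.
  rewrite Z; ring.
Qed.

Lemma is_derive_RInt_open_interval (I : R -> Prop) (f : R -> R) (a b : R) :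
  is_open_interval I -> (forall t, I t -> continuous f t) -> I a -> I b ->
  is_derive (fun t => RInt f a t) b (f b).
Proof.
intros HI Hf Ha Hb.
apply (is_derive_RInt (V := R_NormedModule) f _ a b); [ | now apply Hf].
apply filter_imp with (2 := open_interval_locally I b HI Hb); intros t Ht.
apply (RInt_correct (V := R_CompleteNormedModule)).
apply (ex_RInt_continuous (V := R_CompleteNormedModule)); intros u Hu.
now apply Hf, (open_interval_between I a t).
Qed.

Lemma nonzero_same_sign (I : R -> Prop) (f : R -> R) (s0 : R) :
  is_open_interval I -> (forall s, I s -> continuous f s) ->
  (forall s, I s -> f s <> 0) -> I s0 ->
  (forall s, I s -> 0 < f s) \/ (forall s, I s -> f s < 0).
Proof.
intros HI Hf Hn H0.
(* Excluded here is a passage from negative to positive values; the opposite passage is the same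
   fact for [- f]. *)
assert (H : forall g a b, (forall s, I s -> continuous g s) ->
  (forall s, I s -> g s <> 0) -> I a -> I b -> a < b -> g a < 0 -> 0 < g b -> False).
{ intros g a b Hg Hgn Ha Hb Hab H1 H2.
  destruct (IVT_open_interval I g a b 0) as (t & Ht & _ & E); try easy.
  now apply (Hgn t). }
assert (Hopp : forall s, I s -> continuous (fun t => - f t) s)
  by (intros s Hs; apply (continuous_opp (V := R_NormedModule) f), Hf, Hs).
assert (Hoppn : forall s, I s -> - f s <> 0)
  by (intros s Hs E; apply (Hn s Hs); lra).
assert (HH : forall a b, I a -> I b -> f a < 0 -> 0 < f b -> False).
{ intros a b Ha Hb H1 H2.
  destruct (Rtotal_order a b) as [L | [-> | L]]; [ | lra | ].
  - now apply (H f a b).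
  - apply (H (fun t => - f t) b a); try easy; lra. }
destruct (Rdichotomy _ _ (Hn s0 H0)) as [N | P]; [right | left];
  intros s Hs; destruct (Rdichotomy _ _ (Hn s Hs)); try lra; exfalso; eauto.
Qed.

Lemma cos_sin_surjective (p q : R) :
  p * p + q * q = 1 -> exists theta, p = cos theta /\ q = sin theta.
Proof.
intros H.
assert (Hp : -1 <= p <= 1) by nra.
assert (Hs : sqrt (1 - Rsqr p) = Rabs q).
{ rewrite <- sqrt_Rsqr_abs; f_equal; unfold Rsqr; lra. }
destruct (Rle_dec 0 q) as [Hq | Hq].
- exists (acos p); rewrite cos_acos, sin_acos, Hs, Rabs_pos_eq; easy.
- exists (- acos p); rewrite cos_neg, sin_neg, cos_acos, sin_acos, Hs, Rabs_left; lra.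
Qed.

(** * Spherical curves *)

Lemma height_zc (xi : R -> vec3) (s : R) : height xi s = zc (xi s).
Proof. unfold height, dot, e_z, xc, yc, zc; simpl; ring. Qed.

Lemma Derive_height (xi : R -> vec3) (s : R) :
  Derive (height xi) s = zc (velocity xi s).
Proof. apply Derive_ext; intros t; apply height_zc. Qed.

Lemma angular_momentum_eq (xi : R -> vec3) (s : R) :
  angular_momentum xi s =
  xc (velocity xi s) * yc (xi s) - xc (xi s) * yc (velocity xi s).
Proof.
unfold angular_momentum, det3, dot, cross, e_z, xc, yc, zc; simpl; ring.
Qed.

Lemma is_derive_velocity (I : R -> Prop) (xi : R -> vec3) (s : R) :
  spherical_curve I xi -> I s ->
  is_derive (fun t => xc (xi t)) s (xc (velocity xi s)) /\
  is_derive (fun t => yc (xi t)) s (yc (velocity xi s)) /\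
  is_derive (fun t => zc (xi t)) s (zc (velocity xi s)).
Proof.
intros [_ H] Hs; destruct (H s Hs) as ([Hx _] & [Hy _] & [Hz _] & _).
now split; [ | split]; apply Derive_correct.
Qed.

Lemma is_derive_acceleration (I : R -> Prop) (xi : R -> vec3) (s : R) :
  spherical_curve I xi -> I s ->
  is_derive (fun t => xc (velocity xi t)) s (xc (acceleration xi s)) /\
  is_derive (fun t => yc (velocity xi t)) s (yc (acceleration xi s)) /\
  is_derive (fun t => zc (velocity xi t)) s (zc (acceleration xi s)).
Proof.
intros [_ H] Hs.
destruct (H s Hs) as ((_ & Hx & _) & (_ & Hy & _) & (_ & Hz & _) & _).
now split; [ | split]; apply Derive_correct.
Qed.

Lemma is_derive_dot (u v : R -> vec3) (du dv : vec3) (s : R) :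
  is_derive (fun t => xc (u t)) s (xc du) ->
  is_derive (fun t => yc (u t)) s (yc du) ->
  is_derive (fun t => zc (u t)) s (zc du) ->
  is_derive (fun t => xc (v t)) s (xc dv) ->
  is_derive (fun t => yc (v t)) s (yc dv) ->
  is_derive (fun t => zc (v t)) s (zc dv) ->
  is_derive (fun t => dot (u t) (v t)) s (dot du (v s) + dot (u s) dv).
Proof.
intros; unfold dot; eapply is_derive_eq.
- apply is_derive_Rplus; [apply is_derive_Rplus | ]; apply is_derive_Rmult; eassumption.
- cbv beta; ring.
Qed.

Lemma is_derive_locally_const (f : R -> R) (s l c : R) :
  locally s (fun t => f t = c) -> is_derive f s l -> l = 0.
Proof.
intros Hc Hf; rewrite <- (is_derive_unique _ _ _ Hf).
rewrite (Derive_ext_loc f (fun _ => c)) by easy; apply Derive_const.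
Qed.

Lemma dot_comm (u v : vec3) : dot u v = dot v u.
Proof. unfold dot; ring. Qed.

Lemma dot_position_velocity (I : R -> Prop) (xi : R -> vec3) (s : R) :
  spherical_curve I xi -> I s -> dot (xi s) (velocity xi s) = 0.
Proof.
intros Hc Hs; destruct (is_derive_velocity I xi s Hc Hs) as (Hx & Hy & Hz).
assert (H := is_derive_dot xi xi _ _ s Hx Hy Hz Hx Hy Hz).
apply is_derive_locally_const with (c := 1) in H.
- rewrite (dot_comm (velocity xi s)) in H; lra.
- destruct Hc as [HI Hc]; apply filter_imp with (2 := open_interval_locally I s HI Hs).
  intros t Ht; now apply Hc.
Qed.

Lemma dot_velocity_acceleration (I : R -> Prop) (xi : R -> vec3) (s : R) :
  spherical_curve I xi -> I s -> dot (velocity xi s) (acceleration xi s) = 0.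
Proof.
intros Hc Hs; destruct (is_derive_acceleration I xi s Hc Hs) as (Hx & Hy & Hz).
assert (H := is_derive_dot (velocity xi) (velocity xi) _ _ s Hx Hy Hz Hx Hy Hz).
apply is_derive_locally_const with (c := 1) in H.
- rewrite (dot_comm (acceleration xi s)) in H; lra.
- destruct Hc as [HI Hc]; apply filter_imp with (2 := open_interval_locally I s HI Hs).
  intros t Ht; now apply Hc.
Qed.

(** The terms in x'y' cancel and x''y - xy'' remains. The relations <v, v> = 1, <p, v> = 0 and <v,
    a> = 0 for p, v, a = xi, xi', xi'' turn it into kappa z' by a polynomial identity, so xi'' is
    never decomposed in the frame. *)
Lemma is_derive_angular_momentum (I : R -> Prop) (xi : R -> vec3) (s : R) :
  spherical_curve I xi -> I s ->
  is_derive (angular_momentum xi) s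
    (geodesic_curvature xi s * Derive (height xi) s).
Proof.
intros Hc Hs; rewrite Derive_height.
apply (is_derive_ext (fun t => xc (velocity xi t) * yc (xi t)
                               - xc (xi t) * yc (velocity xi t))).
{ intros t; symmetry; apply angular_momentum_eq. }
destruct (is_derive_velocity I xi s Hc Hs) as (Hx & Hy & Hz).
destruct (is_derive_acceleration I xi s Hc Hs) as (Hx' & Hy' & Hz').
eapply is_derive_eq.
{ apply is_derive_Rminus; apply is_derive_Rmult; eassumption. }
cbv beta.
assert (E1 := dot_position_velocity I xi s Hc Hs).
assert (E2 := dot_velocity_acceleration I xi s Hc Hs).
destruct (proj2 Hc s Hs) as (_ & _ & _ & _ & E3).
unfold geodesic_curvature.
generalize dependent (acceleration xi s); generalize dependent (velocity xi s).
generalize (xi s); intros p v; intros _ _ _ E1 E3 a _ _ _ E2.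
(* z-component of a x (v x (p x v)), expanded by the triple product rule in
   two ways. *)
assert (E : (xc a * yc p - yc a * xc p) * dot v v
            - (xc a * yc v - yc a * xc v) * dot p v
            = zc v * det3 p v a - (xc p * yc v - yc p * xc v) * dot v a).
{ unfold det3, dot, cross, xc, yc, zc; simpl; ring. }
rewrite E1, E2, E3 in E; lra.
Qed.

Lemma Derive_height_sqr (I : R -> Prop) (xi : R -> vec3) (s : R) :
  spherical_curve I xi -> I s ->
  Derive (height xi) s ^ 2 = 1 - height xi s ^ 2 - angular_momentum xi s ^ 2.
Proof.
intros Hc Hs; rewrite Derive_height, height_zc, angular_momentum_eq.
assert (E1 := dot_position_velocity I xi s Hc Hs).
destruct (proj2 Hc s Hs) as (_ & _ & _ & E2 & E3).
unfold dot in *.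
set (x := xc (xi s)) in *; set (y := yc (xi s)) in *; set (z := zc (xi s)) in *.
set (x' := xc (velocity xi s)) in *; set (y' := yc (velocity xi s)) in *.
set (z' := zc (velocity xi s)) in *.
(* Lagrange's identity for the horizontal parts of xi and xi'; unit lengths and orthogonality
   express the three factors by z and z'. *)
assert (L : (x' * y - x * y') ^ 2
            = (x * x + y * y) * (x' * x' + y' * y') - (x * x' + y * y') ^ 2) by ring.
rewrite L.
replace (x * x + y * y) with (1 - z * z) by lra.
replace (x' * x' + y' * y') with (1 - z' * z') by lra.
replace (x * x' + y * y') with (- (z * z')) by lra.
ring.
Qed.

(** The horizontal velocity resolved along the horizontal position and its perpendicular;
    multiplying by x^2 + y^2 = 1 - z^2 avoids the division. This makes (x, y) a solution of a linear
    system whose coefficients depend only on z, z' and K, which is why curves sharing these data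
    differ by a rotation. *)
Lemma horizontal_velocity (I : R -> Prop) (xi : R -> vec3) (s : R) :
  spherical_curve I xi -> I s ->
  (1 - zc (xi s) ^ 2) * xc (velocity xi s)
  = - (zc (xi s) * zc (velocity xi s)) * xc (xi s) + angular_momentum xi s * yc (xi s) /\
  (1 - zc (xi s) ^ 2) * yc (velocity xi s)
  = - (zc (xi s) * zc (velocity xi s)) * yc (xi s) - angular_momentum xi s * xc (xi s).
Proof.
intros Hc Hs; rewrite angular_momentum_eq.
assert (E1 := dot_position_velocity I xi s Hc Hs).
destruct (proj2 Hc s Hs) as (_ & _ & _ & E2 & _).
unfold dot in *.
replace (1 - zc (xi s) ^ 2) with (xc (xi s) * xc (xi s) + yc (xi s) * yc (xi s)) by lra.
replace (- (zc (xi s) * zc (velocity xi s)))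
  with (xc (xi s) * xc (velocity xi s) + yc (xi s) * yc (velocity xi s)) by lra.
split; ring.
Qed.

Lemma curvature_momentum (J I : R -> Prop) (kappa : R -> R) (xi : R -> vec3) :
  is_open_interval J -> (forall z, J z -> continuous kappa z) ->
  spherical_curve I xi -> has_curvature kappa J I xi ->
  exists K : R -> R,
    antiderivative_on J kappa K /\ has_momentum K J I xi /\
    forall s, I s ->
      (Derive (height xi) s <> 0 <-> K (height xi s) ^ 2 + height xi s ^ 2 < 1).
Proof.
intros HJ Hk Hc Hcurv.
assert (HI := proj1 Hc).
destruct HI as (_ & [s0 H0] & _).
assert (HI := proj1 Hc).
set (z0 := height xi s0).
(* The constant of integration is the angular momentum at [s0]; the difference of the two momenta
   then has zero derivative along the curve and vanishes at [s0]. *)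
set (K := fun z => angular_momentum xi s0 + RInt kappa z0 z).
assert (HK : antiderivative_on J kappa K).
{ intros z Hz; eapply is_derive_eq.
  - apply is_derive_Rplus; [apply is_derive_Rconst | ].
    apply (is_derive_RInt_open_interval J kappa z0); try easy.
    now apply (Hcurv s0).
  - ring. }
assert (HM : forall s, I s -> angular_momentum xi s = K (height xi s)).
{ intros s Hs.
  assert (E : angular_momentum xi s - K (height xi s)
              = angular_momentum xi s0 - K (height xi s0)).
  { apply (zero_derivative_open_interval I
      (fun t => angular_momentum xi t - K (height xi t))); try easy.
    intros t Ht; eapply is_derive_eq.
    - apply is_derive_Rminus.
      + now apply is_derive_angular_momentum with (1 := Hc).
      + apply is_derive_Rcomp; [now apply HK, Hcurv | ].
        apply (is_derive_ext (fun u => zc (xi u))).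
        * intros u; symmetry; apply height_zc.
        * now apply (is_derive_velocity I).
    - rewrite Derive_height, (proj2 (Hcurv t Ht)); ring. }
  assert (E0 : K (height xi s0) = angular_momentum xi s0).
  { unfold K, z0; rewrite (RInt_point (V := R_CompleteNormedModule)).
    apply Rplus_0_r. }
  lra. }
exists K; split; [easy | split].
- intros s Hs; split; [now apply Hcurv | now apply HM].
- intros s Hs.
  assert (E := Derive_height_sqr I xi s Hc Hs); rewrite (HM s Hs) in E.
  split; intros H.
  + assert (0 < Derive (height xi) s ^ 2) by nra; lra.
  + intros Z; rewrite Z in E; lra.
Qed.

(** * The quadratures *)

(** The value of dz/ds at height z on a curve with z increasing; [1 / speed K t] unfolds to the
    integrand of [arc_length_z]. *)
Definition speed (K : R -> R) (z : R) : R := sqrt (1 - z ^ 2 - K z ^ 2).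

(** The first two conditions of [by_quadratures], separated from the angles. *)
Definition inverts_arc_length (K : R -> R) (J I : R -> Prop) (z0 s0 : R)
    (z : R -> R) : Prop :=
  (forall zeta, J zeta ->
     I (arc_length_z K z0 s0 zeta) /\ z (arc_length_z K z0 s0 zeta) = zeta) /\
  (forall s, I s -> J (z s) /\ arc_length_z K z0 s0 (z s) = s).

Lemma speed_pos (K : R -> R) (J J' : R -> Prop) (z : R) :
  admissible K J J' -> J' z -> 0 < speed K z.
Proof.
intros [_ H] Hz; apply sqrt_lt_R0; specialize (H z Hz); lra.
Qed.

Lemma speed_sqr (K : R -> R) (J J' : R -> Prop) (z : R) :
  admissible K J J' -> J' z -> speed K z * speed K z = 1 - z ^ 2 - K z ^ 2.
Proof.
intros [_ H] Hz; apply sqrt_sqrt; specialize (H z Hz); lra.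
Qed.

Lemma admissible_bound (K : R -> R) (J J' : R -> Prop) (z : R) :
  admissible K J J' -> J' z -> 0 < 1 - z ^ 2 /\ -1 < z < 1.
Proof.
intros [_ H] Hz; specialize (H z Hz).
assert (0 <= K z ^ 2) by apply pow2_ge_0.
split; [lra | split; nra].
Qed.

Lemma is_derive_square (f : R -> R) (x df : R) :
  is_derive f x df -> is_derive (fun t => f t ^ 2) x (2 * f x * df).
Proof.
intros Hf; apply (is_derive_ext (fun t => f t * f t)).
- intros t; simpl; now rewrite Rmult_1_r.
- eapply is_derive_eq; [apply is_derive_Rmult; exact Hf | simpl; ring].
Qed.

Lemma is_derive_speed (kappa K : R -> R) (J J' : R -> Prop) (z : R) :
  antiderivative_on J kappa K -> admissible K J J' -> J' z ->
  is_derive (speed K) z (- (z + K z * kappa z) / speed K z).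
Proof.
intros HK Ha Hz.
assert (Hp := speed_pos K J J' z Ha Hz).
assert (HzJ := proj1 (proj2 Ha z Hz)).
assert (Hb := proj2 (proj2 Ha z Hz)).
unfold speed at 1; eapply is_derive_eq.
- apply is_derive_sqrt; [ | lra].
  apply is_derive_Rminus; [apply is_derive_Rminus | ].
  + apply is_derive_Rconst.
  + apply is_derive_square, (is_derive_id (K := R_AbsRing)).
  + now apply is_derive_square, HK.
- cbv beta; fold (speed K z); unfold one; simpl; field; lra.
Qed.

Lemma continuous_speed_inv (kappa K : R -> R) (J J' : R -> Prop) (z : R) :
  antiderivative_on J kappa K -> admissible K J J' -> J' z ->
  continuous (fun t => 1 / speed K t) z.
Proof.
intros HK Ha Hz.
assert (Hp := speed_pos K J J' z Ha Hz).
apply (continuous_ext (fun t => / speed K t)); [intros t; symmetry; apply Rmult_1_l | ].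
apply continuous_Rinv_comp; [ | lra].
now apply is_derive_continuous with (1 := is_derive_speed kappa K J J' z HK Ha Hz).
Qed.

Lemma is_derive_arc_length_z (kappa K : R -> R) (J J' : R -> Prop) (z0 s0 z : R) :
  antiderivative_on J kappa K -> admissible K J J' -> J' z0 -> J' z ->
  is_derive (arc_length_z K z0 s0) z (1 / speed K z).
Proof.
intros HK Ha H0 Hz; eapply is_derive_eq.
- apply is_derive_Rplus; [apply is_derive_Rconst | ].
  apply (is_derive_RInt_open_interval J' (fun t => 1 / speed K t) z0); try easy.
  + exact (proj1 Ha).
  + intros t Ht; now apply (continuous_speed_inv kappa K J J').
- ring.
Qed.

Lemma speed_inv_pos (K : R -> R) (J J' : R -> Prop) (z : R) :
  admissible K J J' -> J' z -> 0 < 1 / speed K z.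
Proof.
intros Ha Hz; apply Rdiv_lt_0_compat; [lra | now apply (speed_pos K J J')].
Qed.

Lemma arc_length_z_start (K : R -> R) (z0 s0 : R) : arc_length_z K z0 s0 z0 = s0.
Proof.
unfold arc_length_z; rewrite (RInt_point (V := R_CompleteNormedModule)).
apply Rplus_0_r.
Qed.

Lemma inverts_arc_length_start (K : R -> R) (J I : R -> Prop) (z0 s0 : R) (z : R -> R) :
  inverts_arc_length K J I z0 s0 z -> J z0 -> I s0 /\ z s0 = z0.
Proof.
intros [H _] H0; specialize (H z0 H0); now rewrite arc_length_z_start in H.
Qed.

(** The two conditions force [I] to be the image of [J'] under s(z), and ds/dz > 0 makes that image
    an open interval. *)
Lemma inverts_arc_length_interval (kappa K : R -> R) (J J' I : R -> Prop)
    (z0 s0 : R) (z : R -> R) :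
  antiderivative_on J kappa K -> admissible K J J' -> J' z0 ->
  inverts_arc_length K J' I z0 s0 z -> is_open_interval I.
Proof.
intros HK Ha H0 [H1 H2].
apply (open_interval_ext (fun s => exists zeta, J' zeta /\ arc_length_z K z0 s0 zeta = s)).
- intros s; split.
  + intros (zeta & Hz & <-); now apply H1.
  + intros Hs; exists (z s); now apply H2.
- apply image_open_interval with (fun t => 1 / speed K t).
  + exact (proj1 Ha).
  + intros t Ht; now apply (is_derive_arc_length_z kappa K J J').
  + intros t Ht; now apply (speed_inv_pos K J J').
Qed.

Lemma is_derive_inverse_arc_length (kappa K : R -> R) (J J' I : R -> Prop)
    (z0 s0 : R) (z : R -> R) (s : R) :
  antiderivative_on J kappa K -> admissible K J J' -> J' z0 ->
  inverts_arc_length K J' I z0 s0 z -> I s -> is_derive z s (speed K (z s)).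
Proof.
intros HK Ha H0 [H1 H2] Hs.
destruct (H2 s Hs) as [Hz E].
rewrite <- E at 1; eapply is_derive_eq.
- apply (is_derive_inverse J' (arc_length_z K z0 s0) (fun t => 1 / speed K t)); try easy.
  + exact (proj1 Ha).
  + intros t Ht; now apply (is_derive_arc_length_z kappa K J J').
  + intros t Ht; now apply (speed_inv_pos K J J').
  + intros t Ht; now apply (continuous_speed_inv kappa K J J').
  + intros t Ht; now apply H1.
- assert (Hp := speed_pos K J J' (z s) Ha Hz); field; lra.
Qed.

Lemma arc_length_z_inverse (kappa K : R -> R) (J J' : R -> Prop) (z0 s0 : R) :
  antiderivative_on J kappa K -> admissible K J J' -> J' z0 ->
  exists (I : R -> Prop) (z : R -> R), inverts_arc_length K J' I z0 s0 z.
Proof.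
intros HK Ha H0.
set (A := arc_length_z K z0 s0).
set (I := fun s => exists zeta, J' zeta /\ A zeta = s).
(* A preimage in [J'] picked by [epsilon], unspecified outside [I]; strict growth of [A] makes it
   the only one. *)
set (z := fun s => epsilon (inhabits 0) (fun zeta => J' zeta /\ A zeta = s)).
assert (Hz : forall s, I s -> J' (z s) /\ A (z s) = s)
  by (intros s Hs; exact (epsilon_spec (inhabits 0) _ Hs)).
assert (Hinc : forall a b, J' a -> J' b -> a < b -> A a < A b).
{ intros a b Hja Hjb Hab.
  apply (pos_derivative_increasing J' A (fun t => 1 / speed K t)); try easy.
  - exact (proj1 Ha).
  - intros t Ht; now apply (is_derive_arc_length_z kappa K J J').
  - intros t Ht; now apply (speed_inv_pos K J J'). }
exists I, z; split; [ | exact Hz].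
intros zeta Hzeta; assert (Hs : I (A zeta)) by now exists zeta.
split; [exact Hs | ].
destruct (Hz _ Hs) as [Hj E].
destruct (Rtotal_order (z (A zeta)) zeta) as [L | [L | L]]; [ | exact L | ];
  apply Hinc in L; try easy; fold A; lra.
Qed.

(** Substitution t = sin u, with cos^2 u = 1 - sin^2 u in the radicand. *)
Lemma arc_length_phi_z (kappa K : R -> R) (J J' : R -> Prop) (a b s0 : R) :
  antiderivative_on J kappa K -> admissible K J J' -> J' a -> J' b ->
  arc_length_phi K (asin a) s0 (asin b) = arc_length_z K a s0 b.
Proof.
intros HK Ha Hja Hjb.
assert (Ba := proj2 (admissible_bound K J J' a Ha Hja)).
assert (Bb := proj2 (admissible_bound K J J' b Ha Hjb)).
unfold arc_length_phi, arc_length_z; f_equal.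
rewrite (RInt_ext (V := R_CompleteNormedModule) _
  (fun u => scal (cos u) (1 / speed K (sin u)))).
- rewrite (RInt_comp (V := R_CompleteNormedModule) (fun t => 1 / speed K t) sin cos).
  + now rewrite !sin_asin by lra.
  + intros u Hu; apply (continuous_speed_inv kappa K J J'); try easy.
    apply (open_interval_between J' a b); try easy.
    1: exact (proj1 Ha).
    (* On [-pi/2, pi/2] the sine is increasing, so sin u stays between a and b, hence in [J']. *)
    assert (Ia := asin_bound a); assert (Ib := asin_bound b).
    rewrite <- (sin_asin a), <- (sin_asin b) by lra.
    unfold Rmin, Rmax in Hu.
    destruct (Rle_dec (asin a) (asin b)) as [L | L].
    * assert (sin (asin a) <= sin u) by (apply sin_incr_1; lra).
      assert (sin u <= sin (asin b)) by (apply sin_incr_1; lra).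
      rewrite Rmin_left, Rmax_right by lra; lra.
    * assert (sin (asin b) <= sin u) by (apply sin_incr_1; lra).
      assert (sin u <= sin (asin a)) by (apply sin_incr_1; lra).
      rewrite Rmin_right, Rmax_left by lra; lra.
  + intros u _; split; [apply is_derive_sin | apply continuous_cos].
- intros u _; unfold scal; simpl; unfold mult; simpl; unfold speed, Rdiv.
  rewrite Rmult_1_l.
  replace (cos u * (cos u * 1)) with (1 - sin u * (sin u * 1)); [reflexivity | ].
  assert (E := sin2_cos2 u); unfold Rsqr in E; lra.
Qed.

Lemma cos_asin_pow (z : R) : -1 <= z <= 1 -> cos (asin z) ^ 2 = 1 - z ^ 2.
Proof.
intros Hz; rewrite cos_asin by easy.
rewrite pow2_sqrt; unfold Rsqr; nra.
Qed.

(** Only the inverse of s(z) and the longitude integral in z have to be supplied: with phi = asin z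
    the other forms of ds and dlambda follow from cos^2 phi = 1 - z^2. *)
Lemma by_quadratures_intro (kappa K : R -> R) (J J' I : R -> Prop)
    (z0 s0 lambda0 : R) (xi : R -> vec3) (z : R -> R) :
  antiderivative_on J kappa K -> admissible K J J' -> J' z0 ->
  inverts_arc_length K J' I z0 s0 z ->
  (forall s, I s ->
     xi s = geographic (asin (z s))
              (lambda0 + RInt (fun t => K (z t) / (z t ^ 2 - 1)) s0 s)) ->
  by_quadratures K J' I z0 s0 lambda0 xi.
Proof.
intros HK Ha H0 Hz Hxi.
assert (HI := inverts_arc_length_interval kappa K J J' I z0 s0 z HK Ha H0 Hz).
destruct (inverts_arc_length_start K J' I z0 s0 z Hz H0) as [Hs0 Ez0].
exists z, (fun s => asin (z s)),
  (fun s => lambda0 + RInt (fun t => K (z t) / (z t ^ 2 - 1)) s0 s).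
split; [exact (proj1 Hz) | split; [exact (proj2 Hz) | ]].
assert (B : forall s, I s -> 0 < 1 - z s ^ 2 /\ -1 < z s < 1)
  by (intros s Hs; apply (admissible_bound K J J'); [easy | now apply Hz]).
intros s Hs; destruct (proj2 Hz s Hs) as [Hj E].
repeat split.
- apply asin_bound_lt; now apply B.
- apply asin_bound_lt; now apply B.
- symmetry; apply sin_asin; specialize (B s Hs); lra.
- now rewrite Ez0, (arc_length_phi_z kappa K J J').
- f_equal; apply (RInt_ext (V := R_CompleteNormedModule)); intros t Ht.
  destruct (B t) as [B1 B2].
  { apply (open_interval_between I s0 s); try easy; lra. }
  rewrite cos_asin_pow by lra.
  enough (E' : K (z t) / (z t ^ 2 - 1) = - (K (z t) / (1 - z t ^ 2))) by exact E'.
  field; lra.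
- now apply Hxi.
Qed.

(** The latitude lies in (-pi/2, pi/2), so it is forced to be asin z; every curve given by the
    quadratures thus has the normal form accepted by [by_quadratures_intro]. *)
Lemma by_quadratures_elim (K : R -> R) (J J' I : R -> Prop) (z0 s0 lambda0 : R)
    (xi : R -> vec3) :
  admissible K J J' -> by_quadratures K J' I z0 s0 lambda0 xi ->
  exists z, inverts_arc_length K J' I z0 s0 z /\
    forall s, I s ->
      xi s = geographic (asin (z s))
               (lambda0 + RInt (fun t => K (z t) / (z t ^ 2 - 1)) s0 s).
Proof.
intros Ha (z & phi & lambda & H1 & H2 & H3); exists z; split; [now split | ].
intros s Hs; destruct (H3 s Hs) as (Hp & Ez & _ & _ & <- & ->).
now rewrite Ez, asin_sin by lra.
Qed.

(** * Regularity and curvature of the curves given by the quadratures *)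

Definition C1_on (I : R -> Prop) (f : R -> R) : Prop :=
  exists df, forall s, I s -> is_derive f s (df s) /\ continuous df s.

Lemma C1_on_plus (I : R -> Prop) (f g : R -> R) :
  C1_on I f -> C1_on I g -> C1_on I (fun t => f t + g t).
Proof.
intros [df Hf] [dg Hg]; exists (fun t => df t + dg t); intros s Hs.
destruct (Hf s Hs), (Hg s Hs); split; [now apply is_derive_Rplus | ].
now apply (continuous_plus (V := R_NormedModule) df dg).
Qed.

Lemma C1_on_opp (I : R -> Prop) (f : R -> R) :
  C1_on I f -> C1_on I (fun t => - f t).
Proof.
intros [df Hf]; exists (fun t => - df t); intros s Hs.
destruct (Hf s Hs); split; [now apply is_derive_Ropp | ].
now apply (continuous_opp (V := R_NormedModule) df).
Qed.

Lemma C1_on_mult (I : R -> Prop) (f g : R -> R) :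
  C1_on I f -> C1_on I g -> C1_on I (fun t => f t * g t).
Proof.
intros [df Hf] [dg Hg]; exists (fun t => df t * g t + f t * dg t); intros s Hs.
destruct (Hf s Hs) as [Df Cf], (Hg s Hs) as [Dg Cg].
split; [now apply is_derive_Rmult | ].
apply is_derive_continuous in Df; apply is_derive_continuous in Dg.
apply (continuous_plus (V := R_NormedModule) (fun t => df t * g t) (fun t => f t * dg t));
  now apply (continuous_mult (K := R_AbsRing)).
Qed.

Lemma C1_on_inv (I : R -> Prop) (f : R -> R) :
  C1_on I f -> (forall s, I s -> f s <> 0) -> C1_on I (fun t => / f t).
Proof.
intros [df Hf] Hn; exists (fun t => - df t * / (f t * f t)); intros s Hs.
destruct (Hf s Hs) as [Df Cf]; assert (Hns := Hn s Hs); split.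
- eapply is_derive_eq; [apply is_derive_inv; [exact Df | exact Hns] | now field].
- apply is_derive_continuous in Df.
  apply (continuous_mult (K := R_AbsRing) (fun t => - df t) (fun t => / (f t * f t))).
  + now apply (continuous_opp (V := R_NormedModule) df).
  + apply continuous_Rinv_comp; [now apply (continuous_mult (K := R_AbsRing)) | nra].
Qed.

Lemma C1_on_const (I : R -> Prop) (a : R) : C1_on I (fun _ => a).
Proof.
exists (fun _ => 0); intros s _; split; [apply is_derive_Rconst | apply continuous_const].
Qed.

(** [Derive f] and [g] are only known to agree on [I]; as [I] is open they agree near each of its
    points, which suffices to transfer derivatives and continuity. *)
Lemma C2_at_of_derivative (I : R -> Prop) (f g : R -> R) (s : R) :
  is_open_interval I -> (forall t, I t -> is_derive f t (g t)) -> C1_on I g ->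
  I s -> C2_at f s.
Proof.
intros HI Hf [dg Hg] Hs.
assert (L : forall t, I t -> locally t (fun u => Derive f u = g u)).
{ intros t Ht; apply filter_imp with (2 := open_interval_locally I t HI Ht).
  intros u Hu; now apply is_derive_unique, Hf. }
assert (D : forall t, I t -> is_derive (Derive f) t (dg t)).
{ intros t Ht; apply (is_derive_ext_loc g); [ | now apply Hg].
  apply filter_imp with (2 := L t Ht); intros u E; now symmetry. }
split; [ | split].
- exists (g s); now apply Hf.
- exists (dg s); now apply D.
- apply (continuous_ext_loc _ dg); [ | now apply Hg].
  apply filter_imp with (2 := open_interval_locally I s HI Hs).
  intros u Hu; symmetry; now apply is_derive_unique, D.
Qed.

Lemma C1_on_continuous (I : R -> Prop) (f : R -> R) (s : R) :
  C1_on I f -> I s -> continuous f s.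
Proof.
intros [df Hf] Hs; now apply is_derive_continuous with (df s), Hf.
Qed.

Lemma C1_on_one_minus_square (I : R -> Prop) (f : R -> R) :
  C1_on I f -> C1_on I (fun t => 1 - f t ^ 2).
Proof.
intros Hf; apply (C1_on_plus I (fun _ => 1) (fun t => - (f t ^ 2))).
- apply C1_on_const.
- apply (C1_on_opp I (fun t => f t * (f t * 1))).
  apply C1_on_mult; [easy | ].
  now apply (C1_on_mult I f (fun _ => 1)); [ | apply C1_on_const].
Qed.

Lemma by_quadratures_curve (kappa K : R -> R) (J J' I : R -> Prop)
    (z0 s0 lambda0 : R) (xi : R -> vec3) :
  (forall z, J z -> continuous kappa z) -> antiderivative_on J kappa K ->
  admissible K J J' -> J' z0 -> by_quadratures K J' I z0 s0 lambda0 xi ->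
  spherical_curve I xi /\ has_curvature kappa J' I xi /\
  has_momentum K J' I xi /\ forall s, I s -> 0 < Derive (height xi) s.
Proof.
intros Hk HK Ha H0 Hq.
destruct (by_quadratures_elim K J J' I z0 s0 lambda0 xi Ha Hq) as (z & Hz & Hxi).
assert (HI := inverts_arc_length_interval kappa K J J' I z0 s0 z HK Ha H0 Hz).
destruct (inverts_arc_length_start K J' I z0 s0 z Hz H0) as [Hs0 Ez0].
assert (HzJ : forall s, I s -> J' (z s)) by (intros s Hs; now apply Hz).
assert (HzJ2 : forall s, I s -> J (z s)) by (intros s Hs; now apply Ha, HzJ).
assert (B : forall s, I s -> 0 < 1 - z s ^ 2 /\ -1 < z s < 1)
  by (intros s Hs; apply (admissible_bound K J J'); [easy | now apply HzJ]).
set (w := fun s => speed K (z s)).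
assert (Hw : forall s, I s -> 0 < w s)
  by (intros s Hs; apply (speed_pos K J J'); [easy | now apply HzJ]).
assert (Hw2 : forall s, I s -> w s * w s = 1 - z s ^ 2 - K (z s) ^ 2)
  by (intros s Hs; apply (speed_sqr K J J'); [easy | now apply HzJ]).
assert (Dz : forall s, I s -> is_derive z s (w s))
  by (intros s Hs; now apply (is_derive_inverse_arc_length kappa K J J' I z0 s0)).
(* The denominator in [is_derive_speed] cancels against z' = w. The result z'' = - z - kappa K is
   the vertical component of xi'' = - xi + kappa N, since <N, e> = - K. *)
assert (Dw : forall s, I s -> is_derive w s (- (z s + K (z s) * kappa (z s)))).
{ intros s Hs; eapply is_derive_eq.
  - apply (is_derive_Rcomp (speed K) z); [ | now apply Dz].
    now apply (is_derive_speed kappa K J J' _ HK Ha), HzJ.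
  - specialize (Hw s Hs); unfold w in *; field; lra. }
assert (DK : forall s, I s -> is_derive (fun t => K (z t)) s (kappa (z s) * w s)).
{ intros s Hs; apply (is_derive_Rcomp K z); [ | now apply Dz].
  now apply HK, HzJ2. }
assert (Cmult : forall (f g : R -> R) (s : R), continuous f s -> continuous g s ->
  continuous (fun t => f t * g t) s)
  by (intros f g s; apply (continuous_mult (K := R_AbsRing))).
assert (Cplus : forall (f g : R -> R) (s : R), continuous f s -> continuous g s ->
  continuous (fun t => f t + g t) s)
  by (intros f g s; apply (continuous_plus (V := R_NormedModule))).
assert (Copp : forall (f : R -> R) (s : R), continuous f s -> continuous (fun t => - f t) s)
  by (intros f s; apply (continuous_opp (V := R_NormedModule))).
assert (Cz : forall s, I s -> continuous z s)
  by (intros s Hs; now apply is_derive_continuous with (1 := Dz s Hs)).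
assert (Cw : forall s, I s -> continuous w s)
  by (intros s Hs; now apply is_derive_continuous with (1 := Dw s Hs)).
assert (CK : forall s, I s -> continuous (fun t => K (z t)) s)
  by (intros s Hs; now apply is_derive_continuous with (1 := DK s Hs)).
assert (Ck : forall s, I s -> continuous (fun t => kappa (z t)) s)
  by (intros s Hs; apply continuous_comp; [now apply Cz | now apply Hk, HzJ2]).
assert (C1z : C1_on I z) by (exists w; intros s Hs; split; auto).
assert (C1w : C1_on I w).
{ exists (fun s => - (z s + K (z s) * kappa (z s))); intros s Hs; split; [auto | ].
  now apply Copp, Cplus; [auto | apply Cmult; auto]. }
assert (C1K : C1_on I (fun t => K (z t))).
{ exists (fun s => kappa (z s) * w s); intros s Hs; split; [auto | ].
  apply Cmult; auto. }
assert (C1r : C1_on I (fun t => / (1 - z t ^ 2))).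
{ apply C1_on_inv; [now apply C1_on_one_minus_square | ].
  intros s Hs E; specialize (B s Hs); lra. }
set (lam := fun s => lambda0 + RInt (fun t => K (z t) / (z t ^ 2 - 1)) s0 s) in *.
assert (Dlam : forall s, I s -> is_derive lam s (K (z s) / (z s ^ 2 - 1))).
{ intros s Hs; eapply is_derive_eq.
  - apply is_derive_Rplus; [apply is_derive_Rconst | ].
    apply (is_derive_RInt_open_interval I (fun t => K (z t) / (z t ^ 2 - 1)) s0); try easy.
    intros t Ht.
    apply (continuous_ext_loc _ (fun u => K (z u) * - / (1 - z u ^ 2))).
    + apply filter_imp with (2 := open_interval_locally I t HI Ht); intros u Hu.
      enough (E : K (z u) * - / (1 - z u ^ 2) = K (z u) / (z u ^ 2 - 1)) by exact E.
      specialize (B u Hu); field; lra.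
    + apply Cmult; [now apply CK | ].
      now apply (Copp (fun u => / (1 - z u ^ 2))), (C1_on_continuous I).
  - ring. }
(* [r] is cos phi, the distance from the z-axis. *)
set (r := fun s => sqrt (1 - z s ^ 2)).
assert (Hr : forall s, I s -> 0 < r s)
  by (intros s Hs; now apply sqrt_lt_R0, B).
assert (Hr2 : forall s, I s -> 1 - z s ^ 2 = r s * r s)
  by (intros s Hs; symmetry; apply sqrt_sqrt; specialize (B s Hs); lra).
assert (Dr : forall s, I s -> is_derive r s (- (z s * w s) / r s)).
{ intros s Hs; eapply is_derive_eq.
  - apply is_derive_sqrt; [ | now apply B].
    apply is_derive_Rminus; [apply is_derive_Rconst | ].
    now apply is_derive_square, Dz.
  - cbv beta; fold (r s); specialize (Hr s Hs); field; lra. }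
assert (Ex : forall s, I s -> xc (xi s) = r s * cos (lam s)).
{ intros s Hs; rewrite (Hxi s Hs); unfold xc, geographic; simpl; fold (lam s).
  rewrite cos_asin by (specialize (B s Hs); lra).
  unfold r; do 3 f_equal; unfold Rsqr; ring. }
assert (Ey : forall s, I s -> yc (xi s) = r s * sin (lam s)).
{ intros s Hs; rewrite (Hxi s Hs); unfold yc, geographic; simpl; fold (lam s).
  rewrite cos_asin by (specialize (B s Hs); lra).
  unfold r; do 3 f_equal; unfold Rsqr; ring. }
assert (Ez : forall s, I s -> zc (xi s) = z s).
{ intros s Hs; rewrite (Hxi s Hs); unfold zc, geographic; simpl.
  apply sin_asin; specialize (B s Hs); lra. }
assert (Exy : forall s, I s -> xc (xi s) * xc (xi s) + yc (xi s) * yc (xi s) = r s * r s).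
{ intros s Hs; rewrite Ex, Ey by easy.
  assert (E := sin2_cos2 (lam s)); unfold Rsqr in E.
  transitivity (r s * r s * (sin (lam s) * sin (lam s) + cos (lam s) * cos (lam s)));
    [ring | rewrite E; ring]. }
(* The right-hand sides of [horizontal_velocity] with z' = w, divided by 1 - z^2; in this form they
   are C^1 as soon as x and y are. *)
set (x1 := fun t => (- (z t * w t) * xc (xi t) + K (z t) * yc (xi t)) * / (1 - z t ^ 2)).
set (y1 := fun t => (- (z t * w t) * yc (xi t) + - (K (z t) * xc (xi t))) * / (1 - z t ^ 2)).
assert (Dx : forall s, I s -> is_derive (fun t => xc (xi t)) s (x1 s)).
{ intros s Hs; apply (is_derive_ext_loc (fun t => r t * cos (lam t))).
  - apply filter_imp with (2 := open_interval_locally I s HI Hs).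
    intros t Ht; symmetry; now apply Ex.
  - eapply is_derive_eq.
    + apply is_derive_Rmult; [now apply Dr | ].
      apply (is_derive_Rcomp cos lam); [apply is_derive_cos | now apply Dlam].
    + cbv beta; unfold x1; rewrite Ex, Ey by easy.
      replace (z s ^ 2 - 1) with (- (r s * r s)) by (rewrite <- Hr2 by easy; ring).
      rewrite Hr2 by easy; specialize (Hr s Hs); field; lra. }
assert (Dy : forall s, I s -> is_derive (fun t => yc (xi t)) s (y1 s)).
{ intros s Hs; apply (is_derive_ext_loc (fun t => r t * sin (lam t))).
  - apply filter_imp with (2 := open_interval_locally I s HI Hs).
    intros t Ht; symmetry; now apply Ey.
  - eapply is_derive_eq.
    + apply is_derive_Rmult; [now apply Dr | ].
      apply (is_derive_Rcomp sin lam); [apply is_derive_sin | now apply Dlam].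
    + cbv beta; unfold y1; rewrite Ex, Ey by easy.
      replace (z s ^ 2 - 1) with (- (r s * r s)) by (rewrite <- Hr2 by easy; ring).
      rewrite Hr2 by easy; specialize (Hr s Hs); field; lra. }
assert (Dzc : forall s, I s -> is_derive (fun t => zc (xi t)) s (w s)).
{ intros s Hs; apply (is_derive_ext_loc z); [ | now apply Dz].
  apply filter_imp with (2 := open_interval_locally I s HI Hs).
  intros t Ht; symmetry; now apply Ez. }
assert (Cx : forall s, I s -> continuous (fun t => xc (xi t)) s)
  by (intros s Hs; now apply is_derive_continuous with (1 := Dx s Hs)).
assert (Cy : forall s, I s -> continuous (fun t => yc (xi t)) s)
  by (intros s Hs; now apply is_derive_continuous with (1 := Dy s Hs)).
assert (Cr : forall s, I s -> continuous (fun t => / (1 - z t ^ 2)) s)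
  by (intros s Hs; now apply (C1_on_continuous I)).
assert (Czw : forall s, I s -> continuous (fun t => - (z t * w t)) s)
  by (intros s Hs; apply (Copp (fun t => z t * w t)), Cmult; auto).
assert (C1zw : C1_on I (fun t => - (z t * w t)))
  by now apply (C1_on_opp I (fun t => z t * w t)), C1_on_mult.
assert (C1x : C1_on I (fun t => xc (xi t))).
{ exists x1; intros s Hs; split; [auto | ].
  apply (Cmult (fun t => - (z t * w t) * xc (xi t) + K (z t) * yc (xi t))); [ | auto].
  apply (Cplus (fun t => - (z t * w t) * xc (xi t)));
    [apply (Cmult (fun t => - (z t * w t))) | apply (Cmult (fun t => K (z t)))]; auto. }
assert (C1y : C1_on I (fun t => yc (xi t))).
{ exists y1; intros s Hs; split; [auto | ].
  apply (Cmult (fun t => - (z t * w t) * yc (xi t) + - (K (z t) * xc (xi t)))); [ | auto].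
  apply (Cplus (fun t => - (z t * w t) * yc (xi t)));
    [apply (Cmult (fun t => - (z t * w t))); auto | ].
  apply (Copp (fun t => K (z t) * xc (xi t))), Cmult; auto. }
assert (C1x1 : C1_on I x1).
{ apply C1_on_mult; [ | easy].
  apply C1_on_plus; apply C1_on_mult; easy. }
assert (C1y1 : C1_on I y1).
{ apply C1_on_mult; [ | easy].
  apply C1_on_plus; [now apply C1_on_mult | ].
  now apply (C1_on_opp I (fun t => K (z t) * xc (xi t))), C1_on_mult. }
assert (Ev : forall s, I s -> velocity xi s = (x1 s, y1 s, w s)).
{ intros s Hs; unfold velocity; f_equal; [f_equal | ]; apply is_derive_unique; auto. }
assert (Hc : spherical_curve I xi).
{ split; [easy | ]; intros s Hs; split; [ | split; [ | split; [ | split]]].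
  - now apply (C2_at_of_derivative I _ x1).
  - now apply (C2_at_of_derivative I _ y1).
  - now apply (C2_at_of_derivative I _ w).
  - unfold dot; rewrite Exy, Ez by easy; rewrite <- Hr2 by easy; ring.
  - rewrite Ev by easy; unfold dot, xc at 1 2, yc at 1 2, zc; simpl.
    (* The cross terms cancel in x'^2 + y'^2. Substituting K^2 = r^2 - w^2 and z^2 = 1 - r^2 leaves
       1 - w^2 for it. *)
    transitivity (((z s * w s) ^ 2 + K (z s) ^ 2)
      * (xc (xi s) * xc (xi s) + yc (xi s) * yc (xi s)) / (r s * r s) ^ 2 + w s * w s).
    + unfold x1, y1; rewrite Hr2 by easy; specialize (Hr s Hs); field; lra.
    + rewrite Exy by easy.
      replace (K (z s) ^ 2) with (r s * r s - w s * w s)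
        by (rewrite <- Hr2, Hw2 by easy; ring).
      assert (E : z s ^ 2 = 1 - r s * r s) by (rewrite <- Hr2 by easy; ring).
      replace ((z s * w s) ^ 2) with (z s ^ 2 * w s ^ 2) by ring; rewrite E.
      specialize (Hr s Hs); field; lra. }
assert (HM : forall s, I s -> angular_momentum xi s = K (z s)).
{ intros s Hs; rewrite angular_momentum_eq, Ev by easy; unfold xc at 1, yc at 2; simpl.
  transitivity (K (z s) * (xc (xi s) * xc (xi s) + yc (xi s) * yc (xi s)) / (r s * r s)).
  - unfold x1, y1; rewrite Hr2 by easy; specialize (Hr s Hs); field; lra.
  - rewrite Exy by easy; specialize (Hr s Hs); field; lra. }
assert (Hh : forall s, I s -> Derive (height xi) s = w s)
  by (intros s Hs; rewrite Derive_height, Ev by easy; reflexivity).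
split; [easy | split; [ | split]].
- intros s Hs; rewrite height_zc, Ez by easy; split; [now apply HzJ | ].
  (* The momentum equals K(z) along the curve, so its derivative is kappa(z) z' by the chain rule
     and the curvature times z' by [is_derive_angular_momentum]; z' = w > 0 is then cancelled. *)
  assert (E : geodesic_curvature xi s * w s = kappa (z s) * w s).
  { rewrite <- Hh at 1 by easy.
    rewrite <- (is_derive_unique _ _ _ (is_derive_angular_momentum I xi s Hc Hs)).
    rewrite <- (is_derive_unique _ _ _ (DK s Hs)).
    apply Derive_ext_loc.
    apply filter_imp with (2 := open_interval_locally I s HI Hs); exact HM. }
  specialize (Hw s Hs); apply Rmult_eq_reg_r with (w s); lra.
- intros s Hs; rewrite height_zc, Ez by easy; split; [now apply HzJ | now apply HM].
- intros s Hs; rewrite Hh by easy; now apply Hw.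
Qed.

(** * Curves with given angular momentum *)

Lemma momentum_solution_derivative (K : R -> R) (J I : R -> Prop) (xi : R -> vec3) (s : R) :
  momentum_solution K J I xi -> I s ->
  is_derive (height xi) s (Derive (height xi) s) /\
  Derive (height xi) s <> 0 /\
  Rabs (Derive (height xi) s) = speed K (height xi s).
Proof.
intros (Hc & HM & Hlt) Hs.
assert (E := Derive_height_sqr I xi s Hc Hs).
rewrite (proj2 (HM s Hs)) in E; specialize (Hlt s Hs).
split; [ | split].
- rewrite Derive_height; apply (is_derive_ext (fun t => zc (xi t))).
  + intros t; symmetry; apply height_zc.
  + now apply (is_derive_velocity I).
- intros Z; rewrite Z in E; lra.
- unfold speed; rewrite <- E, <- Rsqr_pow2; symmetry; apply sqrt_Rsqr_abs.
Qed.

Lemma momentum_solution_same_sign (K : R -> R) (J I : R -> Prop) (xi : R -> vec3) (s0 : R) :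
  momentum_solution K J I xi -> I s0 ->
  (forall s, I s -> 0 < Derive (height xi) s) \/
  (forall s, I s -> Derive (height xi) s < 0).
Proof.
intros Hm H0; assert (Hc := proj1 Hm).
apply (nonzero_same_sign I _ s0); try easy.
- exact (proj1 Hc).
- intros s Hs; apply (continuous_ext (fun t => zc (velocity xi t))).
  + intros t; symmetry; apply Derive_height.
  + apply is_derive_continuous with (zc (acceleration xi s)).
    now apply (is_derive_acceleration I).
- intros s Hs; now apply (momentum_solution_derivative K J I xi s).
Qed.

Lemma height_range_open_interval (K : R -> R) (J I : R -> Prop) (xi : R -> vec3) :
  momentum_solution K J I xi -> is_open_interval (height_range I xi).
Proof.
intros Hm; assert (HI := proj1 (proj1 Hm)).
assert (Hs0 := HI); destruct Hs0 as (_ & [s0 H0] & _).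
destruct (momentum_solution_same_sign K J I xi s0 Hm H0) as [P | N].
- apply image_open_interval with (Derive (height xi)); try easy.
  intros t Ht; now apply (momentum_solution_derivative K J I xi t).
(* Here z decreases, and its range is also that of t -> z(- t), which increases on [reversed I]. *)
- apply (open_interval_ext (fun y => exists t, reversed I t /\ height xi (- t) = y)).
  + intros y; split; intros (t & Ht & E); exists (- t); [easy | ].
    unfold reversed; now rewrite Ropp_involutive.
  + apply (image_open_interval (reversed I) (fun t => height xi (- t))
             (fun t => Derive (height xi) (- t) * - 1)).
    * now apply open_interval_reversed.
    * intros t Ht; apply (is_derive_Rcomp (height xi) Ropp).
      -- now apply (momentum_solution_derivative K J I xi (- t)).
      -- apply is_derive_Ropp, (is_derive_id (K := R_AbsRing)).
    * intros t Ht; specialize (N (- t) Ht); lra.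
Qed.

Lemma height_range_admissible (K : R -> R) (J I : R -> Prop) (xi : R -> vec3) :
  momentum_solution K J I xi -> admissible K J (height_range I xi).
Proof.
intros Hm; split; [now apply (height_range_open_interval K J) | ].
intros z (s & Hs & <-); split; now apply Hm.
Qed.

(** By ds/dz = 1 / speed the function s(f t) - eps t has zero derivative. With eps = 1 this recovers
    the arc parameter from the height; with eps = 1 or eps = -1 it aligns the parameters of two
    curves. *)
Lemma arc_length_along (kappa K : R -> R) (J J' D : R -> Prop) (z0 s0 eps : R)
    (f : R -> R) (a b : R) :
  antiderivative_on J kappa K -> admissible K J J' -> J' z0 -> is_open_interval D ->
  (forall t, D t -> J' (f t) /\ is_derive f t (eps * speed K (f t))) ->
  D a -> D b ->
  arc_length_z K z0 s0 (f a) - eps * a = arc_length_z K z0 s0 (f b) - eps * b.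
Proof.
intros HK Ha H0 HD Hf Hda Hdb.
apply (zero_derivative_open_interval D (fun t => arc_length_z K z0 s0 (f t) - eps * t));
  try easy.
intros t Ht; destruct (Hf t Ht) as [Hj Df]; eapply is_derive_eq.
- apply is_derive_Rminus.
  + apply (is_derive_Rcomp (arc_length_z K z0 s0) f); [ | exact Df].
    now apply (is_derive_arc_length_z kappa K J J').
  + apply (is_derive_Rmult (fun _ => eps)); [apply is_derive_Rconst | ].
    apply (is_derive_id (K := R_AbsRing)).
- assert (Hp := speed_pos K J J' (f t) Ha Hj).
  unfold one; simpl; field; lra.
Qed.

(** The relation between [dn] and [dd] is equality of logarithmic derivatives, cleared of
    denominators because [n] may vanish. *)
Lemma proportional_derivatives_quotient (n d : R -> R) (s dn dd : R) :
  is_derive n s dn -> is_derive d s dd -> d s <> 0 -> dn * d s = n s * dd ->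
  is_derive (fun t => n t * / d t) s 0.
Proof.
intros Hn Hd Hz E; eapply is_derive_eq.
- apply is_derive_Rmult; [exact Hn | ].
  apply is_derive_inv; [exact Hd | exact Hz].
- cbv beta.
  transitivity ((dn * d s - n s * dd) * / (d s * d s)); [now field | ].
  rewrite E; ring.
Qed.

(* The horizontal scalar and cross products of the two curves both have
   logarithmic derivative - 2 z z' / (1 - z^2), so they are constant multiples
   of 1 - z^2; the multiples are the cosine and the sine of the rotation angle. *)
Lemma same_height_rotation (K : R -> R) (J1 J2 I1 I2 D : R -> Prop)
    (xi1 xi2 : R -> vec3) (tau : R) :
  momentum_solution K J1 I1 xi1 -> momentum_solution K J2 I2 xi2 ->
  is_open_interval D ->
  (forall s, D s -> I1 s /\ I2 (s + tau) /\ height xi2 (s + tau) = height xi1 s /\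
     Derive (height xi2) (s + tau) = Derive (height xi1) s) ->
  exists theta, forall s, D s -> xi2 (s + tau) = rot_z theta (xi1 s).
Proof.
intros (Hc1 & HM1 & Hlt1) (Hc2 & HM2 & _) HD HH.
assert (H2 : forall s, D s ->
  xc (xi1 s) * xc (xi1 s) + yc (xi1 s) * yc (xi1 s) = 1 - zc (xi1 s) ^ 2 /\
  xc (xi2 (s + tau)) * xc (xi2 (s + tau)) + yc (xi2 (s + tau)) * yc (xi2 (s + tau))
    = 1 - zc (xi1 s) ^ 2 /\ 0 < 1 - zc (xi1 s) ^ 2).
{ intros s Hs; destruct (HH s Hs) as (S1 & S2 & E & _).
  rewrite !height_zc in E.
  destruct (proj2 Hc1 s S1) as (_ & _ & _ & U1 & _).
  destruct (proj2 Hc2 _ S2) as (_ & _ & _ & U2 & _).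
  specialize (Hlt1 s S1); rewrite height_zc in Hlt1.
  unfold dot in U1, U2; rewrite E in U2.
  assert (0 <= K (zc (xi1 s)) ^ 2) by apply pow2_ge_0.
  split; [ | split]; lra. }
assert (Shift : forall (f : R -> R) (s l : R), is_derive f (s + tau) l ->
  is_derive (fun t => f (t + tau)) s l).
{ intros f s l Hf; eapply is_derive_eq.
  - apply (is_derive_Rcomp f (fun t => t + tau)); [exact Hf | ].
    apply is_derive_Rplus; [apply (is_derive_id (K := R_AbsRing)) | apply is_derive_Rconst].
  - unfold one; simpl; ring. }
set (P := fun t => (xc (xi1 t) * xc (xi2 (t + tau)) + yc (xi1 t) * yc (xi2 (t + tau)))
                   * / (1 - zc (xi1 t) ^ 2)).
set (Q := fun t => (xc (xi1 t) * yc (xi2 (t + tau)) - yc (xi1 t) * xc (xi2 (t + tau)))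
                   * / (1 - zc (xi1 t) ^ 2)).
assert (DPQ : forall s, D s -> is_derive P s 0 /\ is_derive Q s 0).
{ intros s Hs; destruct (HH s Hs) as (S1 & S2 & E & E').
  destruct (H2 s Hs) as (_ & _ & Hp).
  destruct (is_derive_velocity I1 xi1 s Hc1 S1) as (X1 & Y1 & Z1).
  destruct (is_derive_velocity I2 xi2 (s + tau) Hc2 S2) as (X2 & Y2 & _).
  apply (Shift (fun t => xc (xi2 t))) in X2; apply (Shift (fun t => yc (xi2 t))) in Y2.
  destruct (horizontal_velocity I1 xi1 s Hc1 S1) as (A1 & B1).
  destruct (horizontal_velocity I2 xi2 (s + tau) Hc2 S2) as (A2 & B2).
  rewrite (proj2 (HM1 s S1)) in A1, B1; rewrite (proj2 (HM2 _ S2)) in A2, B2.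
  rewrite E in A2, B2; rewrite !Derive_height in E'; rewrite !height_zc in *.
  rewrite E, E' in A2, B2.
  assert (R1 : is_derive (fun t => 1 - zc (xi1 t) ^ 2) s
                 (0 - 2 * zc (xi1 s) * zc (velocity xi1 s))).
  { apply is_derive_Rminus; [apply is_derive_Rconst | ].
    apply (is_derive_square (fun t => zc (xi1 t))); exact Z1. }
  split.
  - eapply proportional_derivatives_quotient; [ | exact R1 | lra | ].
    + apply is_derive_Rplus; apply is_derive_Rmult; [exact X1 | exact X2 | exact Y1 | exact Y2].
    + cbv beta.
      transitivity (((1 - zc (xi1 s) ^ 2) * xc (velocity xi1 s)) * xc (xi2 (s + tau))
        + xc (xi1 s) * ((1 - zc (xi1 s) ^ 2) * xc (velocity xi2 (s + tau)))
        + ((1 - zc (xi1 s) ^ 2) * yc (velocity xi1 s)) * yc (xi2 (s + tau))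
        + yc (xi1 s) * ((1 - zc (xi1 s) ^ 2) * yc (velocity xi2 (s + tau)))); [ring | ].
      rewrite A1, A2, B1, B2; ring.
  - eapply proportional_derivatives_quotient; [ | exact R1 | lra | ].
    + apply is_derive_Rminus; apply is_derive_Rmult; [exact X1 | exact Y2 | exact Y1 | exact X2].
    + cbv beta.
      transitivity (((1 - zc (xi1 s) ^ 2) * xc (velocity xi1 s)) * yc (xi2 (s + tau))
        + xc (xi1 s) * ((1 - zc (xi1 s) ^ 2) * yc (velocity xi2 (s + tau)))
        - ((1 - zc (xi1 s) ^ 2) * yc (velocity xi1 s)) * xc (xi2 (s + tau))
        - yc (xi1 s) * ((1 - zc (xi1 s) ^ 2) * xc (velocity xi2 (s + tau)))); [ring | ].
      rewrite A1, A2, B1, B2; ring. }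
assert (Hd0 := HD); destruct Hd0 as (_ & [d Hd] & _).
(* Lagrange's identity in the plane; one point is enough since [P] and [Q] are constant. *)
assert (PQ : P d * P d + Q d * Q d = 1).
{ destruct (H2 d Hd) as (U1 & U2 & Hp).
  transitivity ((xc (xi1 d) * xc (xi1 d) + yc (xi1 d) * yc (xi1 d))
    * (xc (xi2 (d + tau)) * xc (xi2 (d + tau)) + yc (xi2 (d + tau)) * yc (xi2 (d + tau)))
    * / ((1 - zc (xi1 d) ^ 2) * (1 - zc (xi1 d) ^ 2))).
  - unfold P, Q; field; lra.
  - rewrite U1, U2; field; lra. }
destruct (cos_sin_surjective _ _ PQ) as (theta & Ec & Es).
exists theta; intros s Hs.
destruct (HH s Hs) as (S1 & S2 & E & _); rewrite !height_zc in E.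
destruct (H2 s Hs) as (U1 & _ & Hp).
assert (EP : P s = cos theta).
{ rewrite <- Ec; apply (zero_derivative_open_interval D); try easy.
  intros t Ht; now apply DPQ. }
assert (EQ : Q s = sin theta).
{ rewrite <- Es; apply (zero_derivative_open_interval D); try easy.
  intros t Ht; now apply DPQ. }
unfold rot_z; rewrite <- EP, <- EQ.
rewrite (surjective_pairing (xi2 (s + tau))), (surjective_pairing (fst (xi2 (s + tau)))).
fold (xc (xi2 (s + tau))) (yc (xi2 (s + tau))) (zc (xi2 (s + tau))).
f_equal; [f_equal | exact E].
(* Here x2 (x1^2 + y1^2) = x1 (x1 x2 + y1 y2) - y1 (x1 y2 - y1 x2), and similarly for y2. *)
- transitivity (xc (xi2 (s + tau)) * (xc (xi1 s) * xc (xi1 s) + yc (xi1 s) * yc (xi1 s))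
    * / (1 - zc (xi1 s) ^ 2)).
  + rewrite U1; field; lra.
  + unfold P, Q; ring.
- transitivity (yc (xi2 (s + tau)) * (xc (xi1 s) * xc (xi1 s) + yc (xi1 s) * yc (xi1 s))
    * / (1 - zc (xi1 s) ^ 2)).
  + rewrite U1; field; lra.
  + unfold P, Q; ring.
Qed.

Lemma rot_z_geographic (theta phi lambda : R) :
  rot_z theta (geographic phi lambda) = geographic phi (theta + lambda).
Proof.
unfold rot_z, geographic, xc, yc, zc; simpl; rewrite cos_plus, sin_plus.
f_equal; f_equal; ring.
Qed.

Lemma height_inverts_arc_length (kappa K : R -> R) (J J' I : R -> Prop)
    (xi : R -> vec3) (s0 : R) :
  antiderivative_on J kappa K -> momentum_solution K J I xi ->
  admissible K J J' -> (forall z, J' z <-> height_range I xi z) -> I s0 ->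
  (forall s, I s -> 0 < Derive (height xi) s) ->
  inverts_arc_length K J' I (height xi s0) s0 (height xi).
Proof.
intros HK Hm Ha HJ' H0 Hpos.
assert (HJ : forall s, I s -> J' (height xi s))
  by (intros s Hs; apply HJ'; now exists s).
assert (E : forall s, I s -> arc_length_z K (height xi s0) s0 (height xi s) = s).
{ intros s Hs.
  assert (E : arc_length_z K (height xi s0) s0 (height xi s) - 1 * s
              = arc_length_z K (height xi s0) s0 (height xi s0) - 1 * s0).
  { apply (arc_length_along kappa K J J' I); try easy.
    - now apply HJ.
    - exact (proj1 (proj1 Hm)).
    - intros t Ht; split; [now apply HJ | ].
      destruct (momentum_solution_derivative K J I xi t Hm Ht) as (Dt & _ & Es).
      rewrite Rabs_pos_eq in Es by (specialize (Hpos t Ht); lra).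
      rewrite Rmult_1_l, <- Es; exact Dt. }
  rewrite arc_length_z_start in E; lra. }
split.
- intros zeta Hz; apply HJ' in Hz; destruct Hz as (s & Hs & <-).
  now rewrite E.
- intros s Hs; split; [now apply HJ | now apply E].
Qed.

(** The curve [eta] is built from the heights of [xi] with longitude constant 0. It has the same
    heights and momentum, so [xi] is [eta] rotated by some theta, which is absorbed into the
    longitude as lambda0. [J'] is given up to equivalence with the range so that the range of a
    curve also serves for its mirror reversal. *)
Lemma increasing_solution_by_quadratures (kappa K : R -> R) (J J' I : R -> Prop)
    (xi : R -> vec3) (s0 : R) :
  (forall z, J z -> continuous kappa z) -> antiderivative_on J kappa K ->
  momentum_solution K J I xi ->
  (forall z, J' z <-> height_range I xi z) -> I s0 ->
  (forall s, I s -> 0 < Derive (height xi) s) ->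
  exists lambda0, by_quadratures K J' I (height xi s0) s0 lambda0 xi.
Proof.
intros Hk HK Hm HJ' H0 Hpos.
assert (Ha : admissible K J J').
{ destruct (height_range_admissible K J I xi Hm) as [Ho Hb]; split.
  - now apply (open_interval_ext (height_range I xi)); [intros t; split; apply HJ' | ].
  - intros z Hz; now apply Hb, HJ'. }
assert (Hz0 : J' (height xi s0)) by (apply HJ'; now exists s0).
assert (Hinv := height_inverts_arc_length kappa K J J' I xi s0 HK Hm Ha HJ' H0 Hpos).
set (L := fun s => RInt (fun t => K (height xi t) / (height xi t ^ 2 - 1)) s0 s).
set (eta := fun s => geographic (asin (height xi s)) (0 + L s)).
assert (Hq : by_quadratures K J' I (height xi s0) s0 0 eta)
  by now apply (by_quadratures_intro kappa K J J' I _ s0 0 eta (height xi)).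
destruct (by_quadratures_curve kappa K J J' I _ s0 0 eta Hk HK Ha Hz0 Hq)
  as (Hc & _ & HM & Hpos').
assert (Hh : forall s, I s -> height eta s = height xi s).
{ intros s Hs; rewrite (height_zc eta); unfold eta, geographic, zc; simpl.
  apply sin_asin.
  assert (B := admissible_bound K J J' (height xi s) Ha (proj1 (proj2 Hinv s Hs))).
  lra. }
assert (Hm' : momentum_solution K J' I eta).
{ split; [easy | split; [easy | ]]; intros s Hs.
  rewrite Hh by easy; now apply Hm. }
destruct (same_height_rotation K J' J I I I eta xi 0 Hm' Hm) as (theta & Ht).
- exact (proj1 Hc).
- intros s Hs; rewrite Rplus_0_r; split; [easy | split; [easy | split]].
  + now rewrite Hh.
  + destruct (momentum_solution_derivative K J I xi s Hm Hs) as (_ & _ & E).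
    destruct (momentum_solution_derivative K J' I eta s Hm' Hs) as (_ & _ & E').
    rewrite Hh, <- E in E' by easy.
    specialize (Hpos s Hs); specialize (Hpos' s Hs).
    rewrite !Rabs_pos_eq in E' by lra; now symmetry.
- exists theta; apply (by_quadratures_intro kappa K J J' I _ s0 theta xi (height xi));
    try easy.
  intros s Hs; specialize (Ht s Hs); rewrite Rplus_0_r in Ht; rewrite Ht.
  unfold eta; rewrite rot_z_geographic, Rplus_0_l; reflexivity.
Qed.

(** * Mirror reversal of a curve *)

Lemma is_derive_reversed (f : R -> R) (c s l : R) :
  is_derive f (- s) l -> is_derive (fun t => c * f (- t)) s (- c * l).
Proof.
intros Hf; eapply is_derive_eq.
- apply (is_derive_Rmult (fun _ => c)); [apply is_derive_Rconst | ].
  apply (is_derive_Rcomp f Ropp); [exact Hf | ].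
  apply is_derive_Ropp, (is_derive_id (K := R_AbsRing)).
- unfold one; simpl; ring.
Qed.

(** The factor [c] is 1 for the coordinates x and z and -1 for y. *)
Lemma C2_at_reversed (I : R -> Prop) (f : R -> R) (c s : R) :
  is_open_interval I -> (forall t, I t -> C2_at f t) -> reversed I s ->
  C2_at (fun t => c * f (- t)) s.
Proof.
intros HI Hf Hs.
apply (C2_at_of_derivative (reversed I) _ (fun t => - c * Derive f (- t))).
- now apply open_interval_reversed.
- intros t Ht; apply is_derive_reversed, Derive_correct, (Hf _ Ht).
- exists (fun t => - - c * Derive (Derive f) (- t)); intros t Ht; split.
  + apply is_derive_reversed, Derive_correct, (Hf _ Ht).
  + apply (continuous_mult (K := R_AbsRing) (fun _ => - - c)).
    * apply continuous_const.
    * apply (continuous_comp Ropp (Derive (Derive f))).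
      -- apply (continuous_opp (V := R_NormedModule) (fun u => u)), continuous_id.
      -- apply (Hf _ Ht).
- exact Hs.
Qed.

Lemma height_mirror_reversed (xi : R -> vec3) (s : R) :
  height (mirror_reversed xi) s = height xi (- s).
Proof. now rewrite !height_zc. Qed.

Lemma velocity_mirror_reversed (I : R -> Prop) (xi : R -> vec3) (s : R) :
  spherical_curve I xi -> reversed I s ->
  velocity (mirror_reversed xi) s =
  (- xc (velocity xi (- s)), yc (velocity xi (- s)), - zc (velocity xi (- s))).
Proof.
intros Hc Hs; destruct (is_derive_velocity I xi (- s) Hc Hs) as (Hx & Hy & Hz).
unfold velocity at 1; f_equal; [f_equal | ]; apply is_derive_unique.
- apply (is_derive_ext (fun t => 1 * xc (xi (- t)))).
  + intros t; apply Rmult_1_l.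
  + eapply is_derive_eq; [apply (is_derive_reversed (fun t => xc (xi t))); exact Hx | ring].
- apply (is_derive_ext (fun t => -1 * yc (xi (- t)))).
  + intros t; enough (E : -1 * yc (xi (- t)) = - yc (xi (- t))) by exact E; ring.
  + eapply is_derive_eq; [apply (is_derive_reversed (fun t => yc (xi t))); exact Hy | ring].
- apply (is_derive_ext (fun t => 1 * zc (xi (- t)))).
  + intros t; apply Rmult_1_l.
  + eapply is_derive_eq; [apply (is_derive_reversed (fun t => zc (xi t))); exact Hz | ring].
Qed.

Lemma C2_at_ext (f g : R -> R) (s : R) :
  (forall t, f t = g t) -> C2_at f s -> C2_at g s.
Proof.
intros E; assert (E1 : forall t, Derive f t = Derive g t)
  by (intros t; now apply Derive_ext).
intros (H1 & H2 & H3); split; [ | split].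
- now apply (ex_derive_ext f).
- now apply (ex_derive_ext (Derive f)).
- apply (continuous_ext (Derive (Derive f))); [ | easy].
  intros t; now apply Derive_ext.
Qed.

(** x' and z' change sign, as does y, while x, z and y' keep theirs; both products in x'y - xy' are
    therefore preserved. *)
Lemma momentum_solution_mirror_reversed (K : R -> R) (J I : R -> Prop) (xi : R -> vec3) :
  momentum_solution K J I xi -> momentum_solution K J (reversed I) (mirror_reversed xi).
Proof.
intros (Hc & HM & Hlt).
assert (HI := proj1 Hc).
split; [split; [now apply open_interval_reversed | ] | split].
- intros s Hs; destruct (proj2 Hc (- s) Hs) as (_ & _ & _ & U & V).
  split; [ | split; [ | split; [ | split]]].
  + apply (C2_at_ext (fun t => 1 * xc (xi (- t)))); [intros t; apply Rmult_1_l | ].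
    apply (C2_at_reversed I (fun t => xc (xi t))); try easy; apply Hc.
  + apply (C2_at_ext (fun t => -1 * yc (xi (- t)))).
    { intros t; unfold mirror_reversed, yc; simpl; ring. }
    apply (C2_at_reversed I (fun t => yc (xi t))); try easy; apply Hc.
  + apply (C2_at_ext (fun t => 1 * zc (xi (- t)))); [intros t; apply Rmult_1_l | ].
    apply (C2_at_reversed I (fun t => zc (xi t))); try easy; apply Hc.
  + rewrite <- U; unfold dot, mirror_reversed, xc, yc, zc; simpl; ring.
  + rewrite <- V, (velocity_mirror_reversed I xi s Hc Hs).
    unfold dot; simpl; unfold xc, yc, zc; simpl; ring.
- intros s Hs; rewrite height_mirror_reversed; destruct (HM (- s) Hs) as [Hj E].
  split; [easy | ]; rewrite <- E, !angular_momentum_eq.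
  rewrite (velocity_mirror_reversed I xi s Hc Hs).
  unfold mirror_reversed, xc, yc, zc; simpl; ring.
- intros s Hs; rewrite height_mirror_reversed; now apply Hlt.
Qed.

Lemma solution_by_quadratures (kappa K : R -> R) (J I : R -> Prop)
    (xi : R -> vec3) (s0 : R) :
  (forall z, J z -> continuous kappa z) -> antiderivative_on J kappa K ->
  momentum_solution K J I xi -> I s0 ->
  exists lambda0 : R,
    ((forall s, I s -> 0 < Derive (height xi) s) /\
     by_quadratures K (height_range I xi) I (height xi s0) s0 lambda0 xi)
    \/
    ((forall s, I s -> Derive (height xi) s < 0) /\
     by_quadratures K (height_range I xi) (reversed I)
       (height xi s0) (- s0) lambda0 (mirror_reversed xi)).
Proof.
intros Hk HK Hm H0.
destruct (momentum_solution_same_sign K J I xi s0 Hm H0) as [P | N].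
- destruct (increasing_solution_by_quadratures kappa K J (height_range I xi) I xi s0)
    as [lambda0 Hq]; try easy.
  exists lambda0; now left.
(* Reversal moves the base point to [- s0] but leaves the range of heights as it is. *)
- destruct (increasing_solution_by_quadratures kappa K J (height_range I xi) (reversed I)
    (mirror_reversed xi) (- s0)) as [lambda0 Hq]; try easy.
  + now apply momentum_solution_mirror_reversed.
  + intros z; split; intros (t & Ht & E); exists (- t);
      rewrite height_mirror_reversed in *; unfold reversed in *;
      now rewrite ?Ropp_involutive.
  + unfold reversed; now rewrite Ropp_involutive.
  + intros s Hs; rewrite Derive_height, (velocity_mirror_reversed I xi s (proj1 Hm) Hs).
    specialize (N (- s) Hs); rewrite Derive_height in N.
    change (0 < - zc (velocity xi (- s))); lra.
  + rewrite height_mirror_reversed, Ropp_involutive in Hq.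
    exists lambda0; now right.
Qed.

(** * Uniqueness over the common range of heights *)

Lemma monotone_preimage_open_interval (I J : R -> Prop) (f df : R -> R) (eps s0 : R) :
  is_open_interval I -> is_open_interval J ->
  (forall t, I t -> is_derive f t (df t)) -> (forall t, I t -> 0 < eps * df t) ->
  I s0 -> J (f s0) -> is_open_interval (fun s => I s /\ J (f s)).
Proof.
intros HI HJ Hf Hp H0 HJ0; split; [ | split].
- intros t [Ht Hj]; apply filter_and; [now apply open_interval_locally | ].
  apply (is_derive_continuous f t (df t)); [now apply Hf | ].
  now apply open_interval_locally.
- now exists s0.
- intros a b t [Ha Hja] [Hb Hjb] Ht.
  assert (HIt : I t) by now apply (proj2 (proj2 HI) a b).
  split; [easy | ].
  apply (open_interval_between J (f a) (f b)); try easy.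
  (* The slopes on [a, t] and [t, b] both have the sign of [eps], so f t lies between f a and f b
     whichever way f varies. *)
  destruct (MVT_open_interval I f df a t) as (c & Hc & _ & E); try easy.
  destruct (MVT_open_interval I f df t b) as (c' & Hc' & _ & E'); try easy.
  assert (Pc := Hp c Hc); assert (Pc' := Hp c' Hc').
  unfold Rmin, Rmax; destruct (Rlt_dec 0 eps) as [L | L].
  + assert (0 < df c) by nra; assert (0 < df c') by nra.
    destruct (Rle_dec (f a) (f b)); nra.
  + assert (df c < 0) by nra; assert (df c' < 0) by nra.
    destruct (Rle_dec (f a) (f b)); nra.
Qed.

(** Let eps be the sign of z' common to both curves. Along each, s(z) - eps s is constant for the
    same function s(z), so points of equal height differ in parameter by a constant, fixed by one
    common height: tau = s2 - s1. After this translation [same_height_rotation] applies on the set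
    [D] of parameters with common height. *)
Lemma solution_unique (kappa K : R -> R) (J I1 I2 : R -> Prop) (xi1 xi2 : R -> vec3) :
  antiderivative_on J kappa K ->
  momentum_solution K J I1 xi1 -> momentum_solution K J I2 xi2 ->
  (forall s1 s2, I1 s1 -> I2 s2 ->
     0 < Derive (height xi1) s1 * Derive (height xi2) s2) ->
  exists tau theta : R,
    forall s, I1 s -> height_range I2 xi2 (height xi1 s) ->
      I2 (s + tau) /\ xi2 (s + tau) = rot_z theta (xi1 s).
Proof.
intros HK Hm1 Hm2 Hsign.
set (D := fun s => I1 s /\ height_range I2 xi2 (height xi1 s)).
destruct (classic (exists s, D s)) as [[s1 [H1 (s2 & H2 & E12)]] | No].
(* Without a common height the conclusion is vacuous for any tau and theta. *)
2: { exists 0, 0; intros s Hs Hr; exfalso; apply No; now exists s. }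
set (eps := sign (Derive (height xi2) s2)).
assert (N2 := momentum_solution_derivative K J I2 xi2 s2 Hm2 H2).
assert (Heps : (eps = 1 /\ 0 < Derive (height xi2) s2) \/
               (eps = -1 /\ Derive (height xi2) s2 < 0)).
{ destruct (Rdichotomy _ _ (proj1 (proj2 N2))) as [L | L].
  - right; split; [now apply sign_eq_m1 | easy].
  - left; split; [now apply sign_eq_1 | lra]. }
assert (D1 : forall s, I1 s ->
  is_derive (height xi1) s (eps * speed K (height xi1 s)) /\
  Derive (height xi1) s = eps * speed K (height xi1 s)).
{ intros s Hs; destruct (momentum_solution_derivative K J I1 xi1 s Hm1 Hs) as (Ds & _ & E).
  assert (P := Hsign s s2 Hs H2).
  enough (E' : Derive (height xi1) s = eps * speed K (height xi1 s))
    by (rewrite <- E'; now split).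
  rewrite <- E; destruct Heps as [[-> L] | [-> L]].
  - rewrite Rabs_pos_eq by nra; ring.
  - rewrite Rabs_left1 by nra; ring. }
assert (D2 : forall s, I2 s ->
  is_derive (height xi2) s (eps * speed K (height xi2 s)) /\
  Derive (height xi2) s = eps * speed K (height xi2 s)).
{ intros s Hs; destruct (momentum_solution_derivative K J I2 xi2 s Hm2 Hs) as (Ds & _ & E).
  assert (P := Hsign s1 s H1 Hs); assert (P2 := Hsign s1 s2 H1 H2).
  enough (E' : Derive (height xi2) s = eps * speed K (height xi2 s))
    by (rewrite <- E'; now split).
  rewrite <- E; destruct Heps as [[-> L] | [-> L]].
  - assert (0 < Derive (height xi1) s1) by nra; rewrite Rabs_pos_eq by nra; ring.
  - assert (Derive (height xi1) s1 < 0) by nra; rewrite Rabs_left1 by nra; ring. }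
assert (Ha1 := height_range_admissible K J I1 xi1 Hm1).
assert (Ha2 := height_range_admissible K J I2 xi2 Hm2).
assert (Hee : eps * eps = 1) by (destruct Heps as [[-> _] | [-> _]]; ring).
assert (HD : is_open_interval D).
{ apply (monotone_preimage_open_interval I1 (height_range I2 xi2) (height xi1)
    (fun s => eps * speed K (height xi1 s)) eps s1); try easy.
  - apply Hm1.
  - exact (proj1 Ha2).
  - intros t Ht; now apply D1.
  - intros t Ht; rewrite <- Rmult_assoc, Hee, Rmult_1_l.
    apply (speed_pos K J (height_range I1 xi1)); [easy | now exists t].
  - now exists s2. }
set (tau := s2 - s1).
assert (HS : forall s, D s -> I2 (s + tau) /\ height xi2 (s + tau) = height xi1 s).
{ intros s Hs; assert (Hs' := Hs); destruct Hs' as (Hs1 & s' & Hs2 & E).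
  (* One arc length function for both curves; only its differences matter, so the initial value 0 is
     arbitrary. *)
  set (A := arc_length_z K (height xi2 s2) 0).
  assert (E1 : A (height xi1 s1) - eps * s1 = A (height xi1 s) - eps * s).
  { apply (arc_length_along kappa K J (height_range I2 xi2) D); try easy.
    - now exists s2.
    - intros t [Ht Hr]; split; [easy | now apply D1].
    - split; [easy | now exists s2]. }
  assert (E2 : A (height xi2 s2) - eps * s2 = A (height xi2 s') - eps * s').
  { apply (arc_length_along kappa K J (height_range I2 xi2) I2); try easy.
    - now exists s2.
    - exact (proj1 (proj1 Hm2)).
    - intros t Ht; split; [now exists t | now apply D2]. }
  rewrite E12, E in E2.
  assert (Es : s' = s + tau).
  { unfold tau; assert (Es : eps * (s' - s - (s2 - s1)) = 0) by lra.
    apply Rmult_integral in Es; destruct Es as [Z | Z]; [ | lra].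
    rewrite Z in Hee; lra. }
  rewrite <- Es; now split. }
destruct (same_height_rotation K J J I1 I2 D xi1 xi2 tau Hm1 Hm2 HD) as (theta & Ht).
{ intros s Hs; destruct (HS s Hs) as [Hs2 E].
  split; [now apply Hs | split; [easy | split; [easy | ]]].
  rewrite (proj2 (D1 s (proj1 Hs))), (proj2 (D2 _ Hs2)), E; reflexivity. }
exists tau, theta; intros s Hs Hr.
split; [now apply HS | now apply Ht].
Qed.

(** Continuity of K^2 + z^2 keeps the strict inequality on a ball, which in R is an open
    interval. *)
Lemma admissible_neighbourhood (kappa K : R -> R) (J : R -> Prop) (z0 : R) :
  is_open_interval J -> antiderivative_on J kappa K -> J z0 ->
  K z0 ^ 2 + z0 ^ 2 < 1 ->
  exists J' : R -> Prop, admissible K J J' /\ J' z0.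
Proof.
intros HJ HK H0 Hlt.
assert (D : is_derive (fun z => K z ^ 2 + z ^ 2) z0 (2 * K z0 * kappa z0 + 2 * z0 * 1)).
{ apply is_derive_Rplus; apply is_derive_square; [now apply HK | ].
  apply (is_derive_id (K := R_AbsRing)). }
apply is_derive_continuous in D.
assert (L : locally z0 (fun z => J z /\ K z ^ 2 + z ^ 2 < 1)).
{ apply filter_and; [now apply open_interval_locally | ].
  exact (D _ (open_lt 1 _ Hlt)). }
destruct L as [d Hd]; assert (Hd0 := cond_pos d).
exists (fun z => z0 - d < z < z0 + d).
split; [split; [split; [ | split] | ] | lra].
- intros z [Hz1 Hz2]; apply (locally_interval _ z (z0 - d) (z0 + d)); try easy.
- exists z0; lra.
- intros a b t Ha Hb Ht; lra.
- intros z Hz; apply Hd, ball_Rabs, Rabs_def1; lra.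
Qed.

Theorem theorem2p1 (J : R -> Prop) (kappa : R -> R)
    (hJ : is_open_interval J)
    (hkappa : forall z, J z -> continuous kappa z) :
  (* The angular momentum of a curve of curvature kappa(z) is an
     antiderivative K(z) of kappa(z), and z is non-stationary exactly where
     K(z)^2 + z^2 < 1. *)
  (forall (I : R -> Prop) (xi : R -> vec3),
     spherical_curve I xi -> has_curvature kappa J I xi ->
     exists K : R -> R,
       antiderivative_on J kappa K /\ has_momentum K J I xi /\
       forall s, I s ->
         (Derive (height xi) s <> 0 <->
          K (height xi s) ^ 2 + height xi s ^ 2 < 1))
  /\
  forall K : R -> R, antiderivative_on J kappa K ->
    (* Every point with K(z)^2 + z^2 < 1 has an admissible neighbourhood. *)
    (forall z0, J z0 -> K z0 ^ 2 + z0 ^ 2 < 1 ->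
       exists J' : R -> Prop, admissible K J J' /\ J' z0)
    /\
    (* The quadratures can be carried out and give curves with non-constant z,
       curvature kappa(z) and angular momentum K(z). *)
    (forall (J' : R -> Prop) (z0 s0 lambda0 : R),
       admissible K J J' -> J' z0 ->
       (exists (I : R -> Prop) (xi : R -> vec3),
          by_quadratures K J' I z0 s0 lambda0 xi) /\
       (forall (I : R -> Prop) (xi : R -> vec3),
          by_quadratures K J' I z0 s0 lambda0 xi ->
          spherical_curve I xi /\
          has_curvature kappa J' I xi /\
          has_momentum K J' I xi /\
          forall s, I s -> 0 < Derive (height xi) s))
    /\
    (* Every curve with angular momentum K(z) is given by the quadratures,
       after a mirror reversal when z is decreasing. *)
    (forall (I : R -> Prop) (xi : R -> vec3) (s0 : R),
       momentum_solution K J I xi -> I s0 ->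
       admissible K J (height_range I xi) /\
       exists lambda0 : R,
         ((forall s, I s -> 0 < Derive (height xi) s) /\
          by_quadratures K (height_range I xi) I
            (height xi s0) s0 lambda0 xi)
         \/
         ((forall s, I s -> Derive (height xi) s < 0) /\
          by_quadratures K (height_range I xi) (reversed I)
            (height xi s0) (- s0) lambda0 (mirror_reversed xi)))
    /\
    (* Uniqueness, over the common range of z, up to a rotation around the
       z-axis and a translation of the arc parameter, among curves along which
       z varies in the same direction. *)
    (forall (I1 I2 : R -> Prop) (xi1 xi2 : R -> vec3),
       momentum_solution K J I1 xi1 ->
       momentum_solution K J I2 xi2 ->
       (forall s1 s2, I1 s1 -> I2 s2 ->
          0 < Derive (height xi1) s1 * Derive (height xi2) s2) ->
       exists tau theta : R,
         forall s, I1 s -> height_range I2 xi2 (height xi1 s) ->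
           I2 (s + tau) /\ xi2 (s + tau) = rot_z theta (xi1 s)).
Proof.
split; [ | intros K HK; split; [ | split; [ | split]]].
- intros I xi Hc Hcurv; now apply curvature_momentum.
- intros z0 H0 Hlt; now apply (admissible_neighbourhood kappa K J z0).
- intros J' z0 s0 lambda0 Ha H0; split.
  + destruct (arc_length_z_inverse kappa K J J' z0 s0 HK Ha H0) as (I & z & Hz).
    exists I, (fun s => geographic (asin (z s))
      (lambda0 + RInt (fun t => K (z t) / (z t ^ 2 - 1)) s0 s)).
    now apply (by_quadratures_intro kappa K J J' I z0 s0 lambda0 _ z).
  + intros I xi Hq; now apply (by_quadratures_curve kappa K J J' I z0 s0 lambda0).
- intros I xi s0 Hm H0; split.
  + now apply height_range_admissible.
  + now apply (solution_by_quadratures kappa K J I xi s0).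
- intros I1 I2 xi1 xi2; now apply (solution_unique kappa K J).
Qed.
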